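(* Consider a branching random walk in an i.i.d. time-inhomogeneous random environment $\xi=(F_k)_{k\in\mathbb{Z}}$ with jump law $\mu$, satisfying assumptions (i) and (ii) of the context, and assume in addition that $\mathbb{E}[\eta_1]<\infty$. Let $M$ be its maximal displacement. Then for $P_E$-almost every environment $\xi$, $$\lim_{x\to\infty}\frac1x\log P_\xi(M\ge x)=-\lambda_0,$$ where $\lambda_0:=\kappa(-a)$, i.e. $\lambda_0$ is the unique positive solution of $\Lambda_s(\lambda_0)=-a$, with $a=\mathbb{E}[X_1]$.
   Context: Let $\mathbb{N}_0=\{0,1,2,\dots\}$ and let $\mathcal{P}(\mathbb{N}_0)$ be the space of probability measures on $\mathbb{N}_0$ with the total variation metric. For $F\in\mathcal{P}(\mathbb{N}_0)$ put $\overline F=\sum_{k\ge0}kF[k]$ and $\tilde F=\overline F^{-2}\sum_{k\ge1}k(k-1)F[k]$. The environment $\xi=(F_k)_{k\in\mathbb{Z}}$ is, under the probability $P_E$, an i.i.d. sequence of random elements of $\mathcal{P}(\mathbb{N}_0)$. Put $X_k=\log\overline{F}_k$ and $\eta_k=\tilde F_k$. Given $\xi$, the quenched law $P_\xi$ is that of the following branching random walk: there is one particle at position $0$ in generation $0$; for $k\ge1$ each particle of generation $k-1$ independently has a number of children with law $F_k$; each child's position is its parent's position plus an independent displacement with law $\mu$. $M$ is the supremum of the positions of all particles over all generations. The annealed law is $\mathbb{P}(\cdot)=\int P_\xi(\cdot)\,P_E(d\xi)$, with expectation $\mathbb{E}$. Assumptions: (i) $a:=\mathbb{E}[X_1]\in(-\infty,0)$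 and $\Lambda_e(\rho):=\log\mathbb{E}[e^{\rho X_1}]<\infty$ for all $\rho\ge0$. (ii) $\mu$ is a probability measure supported on $\mathbb{Z}$, non-trivial (not a point mass), with $\mu([2,\infty))=0$ and mean $0$. Put $\Lambda_s(\lambda):=\log\int e^{\lambda y}\mu(dy)<\infty$ for $\lambda>0$. For $\delta>0$, $\kappa(\delta)$ denotes the unique solution in $(0,\infty)$ of $\Lambda_s(\lambda)=\delta$. *)

(* Defs.v *)
From HB Require Import structures.
From mathcomp Require Import all_boot all_order all_algebra.
From mathcomp Require Import all_classical all_reals all_analysis.

Set Implicit Arguments.
Unset Strict Implicit.
Unset Printing Implicit Defensive.

Import Order.TTheory GRing.Theory Num.Theory.
Import numFieldNormedType.Exports.

Local Open Scope classical_set_scope.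
Local Open Scope ring_scope.
Local Open Scope ereal_scope.

Definition mutual_independence d (T : measurableType d) (R : realType)
    (P : probability T R) (I : eqType) (G : I -> set_system T) : Prop :=
  forall (s : seq I) (E : I -> set T), uniq s ->
    (forall i, i \in s -> G i (E i)) ->
    P (\bigcap_(i in [set` s]) E i) = \prod_(i <- s) P (E i).

Section offspring_laws.
Context (R : realType).
Implicit Types F G : probability nat R.

Definition tv_dist F G : R :=
  sup [set `|fine (F A) - fine (G A)|%R | A in [set: set nat]].

Definition tv_open : set_system (probability nat R) :=
  [set U | forall F, U F ->
    exists2 e : R, (0 < e)%R & forall G, (tv_dist F G < e)%R -> U G].

Definition tv_borel : set_system (probability nat R) := <<s tv_open >>.

(* Values in [0, +oo]. *)
Definition mean_offspring F : \bar R :=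
  \sum_(0 <= k <oo) (k%:R%:E * F [set k]).

(* The inverse is taken in \bar R, with 0^-1 = +oo and +oo^-1 = 0. *)
Definition norm_fact_moment F : \bar R :=
  ((mean_offspring F)^-1) ^+ 2 *
  \sum_(1 <= k <oo) ((k * k.-1)%:R%:E * F [set k]).

End offspring_laws.

Section environment.
Context d (Omega : measurableType d) (R : realType) (PE : probability Omega R).
Implicit Type xi : int -> Omega -> probability nat R.

Definition iid_environment xi : Prop :=
  [/\ forall k B, tv_borel B -> measurable (xi k @^-1` B),
      forall k B, tv_borel B -> PE (xi k @^-1` B) = PE (xi 0%R @^-1` B) &
      mutual_independence PE
        (fun k => preimage_set_system setT (xi k) (@tv_borel R))].

(* Values in [-oo, +oo], with log 0 = -oo. *)
Definition log_mean xi (k : int) (w : Omega) : \bar R :=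
  lne (mean_offspring (xi k w)).

Definition eta_ xi (k : int) (w : Omega) : \bar R :=
  norm_fact_moment (xi k w).

Definition Lambda_e xi (rho : R) : \bar R :=
  lne (\int[PE]_w expeR (rho%:E * log_mean xi 1%R w)).

End environment.

Section jump_law.
Context (R : realType) (mu : probability (measurableTypeR R) R).

Definition jump_law_hyp : Prop :=
  [/\ mu (range (fun z : int => z%:~R : R)) = 1,
      ~ (exists c : R, mu [set c] = 1),
      mu [set y : R | (2 <= y)%R] = 0,
      mu.-integrable setT (fun y : R => y%:E) &
      \int[mu]_y (y : R)%:E = 0].

Definition Lambda_s (lambda : R) : \bar R :=
  lne (\int[mu]_y (expR (lambda * (y : R)))%:E).

(* The default value 0 is taken only if no positive solution exists. *)
Definition kappa (delta : R) : R :=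
  xget 0%R [set lambda : R | (0 < lambda)%R /\ Lambda_s lambda = delta%:E].

End jump_law.

(* Branching random walk with Ulam-Harris labels: the individual with label
   u : seq nat belongs to generation size u, [::] is the ancestor, and
   rcons u i is the i-th child of u (counted from 0), which is born when
   i < offspring u.  displacement u is the position of u relative to its parent
   (the value at [::] is never used).  Both variables are attached to all
   labels, whether or not the individual is born.  The environment F is frozen,
   so that brw_law is a quenched law; F 0 and F k for k < 0 play no role. *)
Record brw (R : realType) (mu : probability (measurableTypeR R) R)
    (F : int -> probability nat R) := Brw {
  brw_disp : measure_display ;
  brw_space : measurableType brw_disp ;
  brw_law : probability brw_space R ;
  offspring : seq nat -> brw_space -> nat ;
  displacement : seq nat -> brw_space -> measurableTypeR R ;
  offspring_measurable : forall u, measurable_fun setT (offspring u) ;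
  displacement_measurable : forall u, measurable_fun setT (displacement u) ;
  offspring_distribution : forall u (A : set nat),
    brw_law (offspring u @^-1` A) = F (Posz (size u).+1) A ;
  displacement_distribution : forall u (A : set (measurableTypeR R)),
    measurable A -> brw_law (displacement u @^-1` A) = mu A ;
  brw_independence : mutual_independence brw_law
    (fun v : seq nat + seq nat => match v with
     | inl u => preimage_set_system setT (offspring u) measurable
     | inr u => preimage_set_system setT (displacement u) measurable
     end) }.

Arguments brw_space {R mu F}.
Arguments brw_law {R mu F}.
Arguments offspring {R mu F}.
Arguments displacement {R mu F}.

Section maximal_displacement.
Context (R : realType) (mu : probability (measurableTypeR R) R).
Context (F : int -> probability nat R) (B : brw mu F).
Implicit Types (u : seq nat) (w : brw_space B).

Definition born w u : bool :=
  [forall j : 'I_(size u), (nth 0 u j < offspring B (take j u) w)%N].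

Definition position w u : R :=
  (\sum_(j < size u) (displacement B (take j.+1 u) w : R))%R.

Definition max_displacement w : \bar R :=
  ereal_sup [set (position w u)%:E | u in [set u | born w u]].

Definition quenched_tail (x : R) : \bar R :=
  brw_law B [set w | x%:E <= max_displacement w].

End maximal_displacement.

(* Main.v *)
Require Import Defs.
From HB Require Import structures.
From mathcomp Require Import all_boot all_order all_algebra.
From mathcomp Require Import all_classical all_reals all_analysis.
From mathcomp Require Import measurable_realfun.
From mathcomp Require Import ring lra zify.
Import Order.TTheory GRing.Theory Num.Theory.
Import numFieldNormedType.Exports.

Local Open Scope classical_set_scope.
Local Open Scope ring_scope.
Local Open Scope ereal_scope.

Set Implicit Arguments.
Unset Strict Implicit.


(** Write [S n] for the sum of the first [n] log-means and [phi lambda] for the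
expectation of [e ^ (lambda * jump)]. Almost surely jumps are integers at most 1, so for a
natural number [z] the maximal displacement exceeds [z - 1] if and only if some particle
sits exactly at [z]. Its probability is the limit in [N] of [hit N 0 z], and the
branching property yields a closed recursion for [hit N k z], in which the
offspring law of the next generation acts through [1 - f (1 - s)], where [s] is an
average of hitting probabilities one generation later ([probability_nohit],
[quenched_tail_ge], [quenched_tail_le]). The theorem is thus reduced to estimating
a deterministic recursion with environment coefficients.

Upper bound. As [1 - f (1 - s) <= m s], the expected number of first passages at
[z] is a bound, and Chernoff's inequality gives
[e ^ (- lambda z) * sup over n of e ^ (S n) * phi lambda ^ n]. For
[lambda < lambda0] we have [ln (phi lambda) < - a], and [S n] is [n a] up to a
small multiple of [n], so the supremum is finite ([hit_upper], [tail_upper]).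

Lower bound. The linearised recursion has the solution [e ^ (- lambda0 z)] when
[S n = n a]. Stopping after [T = K z] generations costs only the expected
population [e ^ (a T)], which is negligible for large [K]
([expected_hits_ge]). To return from expectations to probabilities, the second
moment method in one generation gives [1 - f (1 - s) >= m s / (1 + eta m s)], where
[eta] is the normalised second factorial moment ([hit_by_second_moment]). As the
population is subcritical, the expected number of first passages from any
generation is bounded by a subexponential [D], and then the probability is at least
the expectation divided by [1 + D * sum of the eta k] ([hit_ge_expected]).

For almost every environment the log-means average to [a] and the sum of the
[eta k] grows at most linearly ([environment_typical]). Both facts come from the
strong law of large numbers, proved by Etemadi's method
([strong_law_of_large_numbers]). Since the fluctuations of [S n] and the sum of the
[eta k] contribute only factors [e ^ (eps z)], the two bounds give the rate
[lambda0] ([tail_upper], [tail_lower], [quenched_tail_cvg]). *)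

(** * Independence of disjoint blocks of variables *)
Section independent_blocks.
Context d (T : measurableType d) (R : realType) (P : probability T R).
Context (I : eqType) (G : I -> set_system T).
Hypothesis G_measurable : forall i A, G i A -> measurable A.
Hypothesis G_setI : forall i, setI_closed (G i).
Hypothesis G_indep : mutual_independence P G.

Definition block_algebra (L : set I) : set_system T :=
  <<s \bigcup_(i in L) G i >>.

(** A pi-system generating the block, on which independence is the product rule
for finite families. *)
Definition cylinder (L : set I) : set_system T :=
  [set A | exists s E, [/\ uniq s, forall i, i \in s -> L i,
     forall i, i \in s -> G i (E i) & A = \bigcap_(i in [set` s]) E i]].

Lemma sub_block_algebra (L L' : set I) :
  L `<=` L' -> block_algebra L `<=` block_algebra L'.
Proof.
move=> LL'; apply: sub_smallest2r; first exact: smallest_sigma_algebra.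
by move=> A [i Li GA]; exists i => //; exact: LL'.
Qed.

Lemma block_algebra_measurable L A : block_algebra L A -> measurable A.
Proof.
apply: (smallest_sub (sigma_algebra_measurable T)) => B [i _]; exact: G_measurable.
Qed.

Lemma cylinder_measurable L A : cylinder L A -> measurable A.
Proof.
move=> [s [E [_ _ GE ->]]]; apply: fin_bigcap_measurable => // i /= /GE.
exact: G_measurable.
Qed.

Lemma cylinder_setI L : setI_closed (cylinder L).
Proof.
move=> _ _ [s [E [us sL GE ->]]] [s' [E' [us' s'L GE' ->]]].
exists (undup (s ++ s')).
exists (fun i => (if i \in s then E i else setT) `&`
                 (if i \in s' then E' i else setT)); split.
- exact: undup_uniq.
- by move=> i; rewrite mem_undup mem_cat => /orP[/sL|/s'L].
- move=> i; rewrite mem_undup mem_cat.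
  case: ifPn => [/GE ?|_]; case: ifPn => [/GE' ?|_] //= _.
  + exact: G_setI.
  + by rewrite setIT.
  + by rewrite setTI.
- apply/seteqP; split => [x [xE xE'] i _ /=|x xEE'].
    by split; case: ifPn => // ?; [exact: xE|exact: xE'].
  split=> i /= ii; have := xEE' i; rewrite /= mem_undup mem_cat ii ?orbT => /(_ isT) [].
    by move=> ? ?.
  by move=> ? ?.
Qed.

Lemma cylinder_gen L : block_algebra L `<=` <<s cylinder L >>.
Proof.
apply: sub_smallest2r; first exact: smallest_sigma_algebra.
move=> A [i Li GiA].
exists [:: i], (fun=> A); split => //.
- by move=> j; rewrite inE => /eqP ->.
- by move=> j; rewrite inE => /eqP ->.
- by rewrite set_cons1 bigcap_set1.
Qed.

Lemma cylinder_indep L L' A B : L `&` L' = set0 ->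
  cylinder L A -> cylinder L' B -> P (A `&` B) = P A * P B.
Proof.
move=> LL' [s [E [us sL GE ->]]] [s' [E' [us' s'L GE' ->]]].
have ss' i : i \in s -> i \in s' -> False.
  by move=> /sL Li /s'L L'i; rewrite -[False]/(set0 i) -LL'.
pose E'' i := if i \in s then E i else E' i.
have us'' : uniq (s ++ s').
  rewrite cat_uniq us us' andbT /=; apply/hasPn => i is'; apply/negP => iss.
  exact: (ss' i).
have E''s i : i \in s -> E'' i = E i by rewrite /E'' => ->.
have E''s' i : i \in s' -> E'' i = E' i.
  by rewrite /E''; case: ifPn => // /ss' /[apply].
have -> : \bigcap_(i in [set` s]) E i = \bigcap_(i in [set` s]) E'' i.
  by apply: eq_bigcapr => i /= /E''s.
have -> : \bigcap_(i in [set` s']) E' i = \bigcap_(i in [set` s']) E'' i.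
  by apply: eq_bigcapr => i /= /E''s'.
rewrite -bigcap_setU.
have -> : [set` s] `|` [set` s'] = [set` s ++ s'].
  apply/seteqP; split => i /=; rewrite mem_cat; first by move=> [->|->]; rewrite ?orbT.
  by move=> /orP.
rewrite !G_indep // ?big_cat //.
- by move=> i is'; rewrite E''s' //; exact: GE'.
- by move=> i is'; rewrite E''s //; exact: GE.
- move=> i; rewrite mem_cat => /orP[is'|is'].
    by rewrite E''s //; exact: GE.
  by rewrite E''s' //; exact: GE'.
Qed.

(** Independence from a fixed event is stable under complements and disjoint
unions, so that Dynkin's theorem carries it from the cylinders to the whole
block. *)
Lemma dynkin_indep B : measurable B ->
  dynkin [set A | measurable A /\ P (A `&` B) = P A * P B].
Proof.
move=> mB; split => /=.
- by rewrite setTI probability_setT mul1e.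
- move=> A [mA AB]; split; first exact: measurableC.
  rewrite probability_setC// setIC -setDE measureD//; last first.
    by rewrite ltey_eq fin_num_measure.
  transitivity (P B - P B * P A); first by congr (_ - _); rewrite setIC muleC.
  by rewrite muleC muleBl ?mul1e 1?[X in _ - X]muleC // ?fin_num_measure //
    fin_num_adde_defr.
- move=> F tF mF; split; first by apply: bigcup_measurable => k _; case: (mF k).
  rewrite setI_bigcupl !measure_bigcup //; last 3 first.
  + by move=> k _; case: (mF k).
  + by move=> k _; apply: measurableI => //; case: (mF k).
  + exact: trivIset_setIr.
  have -> : P B = (fine (P B))%:E by rewrite fineK // fin_num_measure.
  rewrite muleC -nneseriesZl //.
  rewrite fineK ?fin_num_measure //; apply: eq_eseriesr => k _; rewrite muleC.
  by case: (mF k).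
Qed.

(** Dynkin's argument is used twice, on one factor at a time. *)
Lemma block_independence L L' A B : L `&` L' = set0 ->
  block_algebra L A -> block_algebra L' B -> P (A `&` B) = P A * P B.
Proof.
move=> LL' LA LB.
have dI (K : set I) (C : set T) : measurable C ->
    (forall A, cylinder K A -> P (A `&` C) = P A * P C) ->
    forall A, block_algebra K A -> P (A `&` C) = P A * P C.
  move=> mC HC D /cylinder_gen.
  rewrite -setI_closed_g_dynkin_g_sigma_algebra; last exact: cylinder_setI.
  move=> KD; suff : [set A | measurable A /\ P (A `&` C) = P A * P C] D by case.
  move: D KD; apply: (smallest_sub (dynkin_indep mC)) => X KX; split.
    exact: cylinder_measurable KX.
  exact: HC.
have mB := block_algebra_measurable LB.
apply: (dI L) => // A' LA'.
rewrite setIC muleC; apply: (dI L') => //; first exact: cylinder_measurable LA'.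
by move=> B' LB'; rewrite setIC muleC; exact: (cylinder_indep (L := L) (L' := L')).
Qed.

Lemma block_algebra_sigma L : sigma_algebra setT (block_algebra L).
Proof. exact: smallest_sigma_algebra. Qed.

(** The intersection of the first [n] events belongs to the union of their blocks,
which is disjoint from the next one. *)
Lemma block_independence_prod (L : nat -> set I) (A : nat -> set T) n :
  (forall i j, i <> j -> L i `&` L j = set0) ->
  (forall i, block_algebra (L i) (A i)) ->
  P (\bigcap_(i < n) A i) = \prod_(i < n) P (A i).
Proof.
move=> dL LA; rewrite -(big_mkord xpredT (fun i => P (A i))).
suff [] : block_algebra (\bigcup_(i < n) L i) (\bigcap_(i < n) A i) /\
    P (\bigcap_(i < n) A i) = \prod_(0 <= i < n) P (A i) by [].
elim: n => [|n [IH1 IH2]].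
  rewrite !II0 !bigcap_set0 bigcup_set0 big_nil probability_setT; split => //.
  by case: (block_algebra_sigma set0) => s0 sC _; rewrite -setC0 -setTD; exact: sC.
rewrite !IIS !bigcap_setU !bigcup_setU !bigcap_set1 !bigcup_set1 big_nat_recr //=; split.
  have := block_algebra_sigma (\bigcup_(i < n) L i `|` L n).
  set B := block_algebra _ => sB.
  have b1 : B (\bigcap_(i < n) A i) by apply: sub_block_algebra IH1; exact: subsetUl.
  have b2 : B (A n) by apply: sub_block_algebra (LA n); exact: subsetUr.
  rewrite -(setCK (_ `&` _)) setCI; case: (sB) => _ sC _.
  rewrite -setTD; apply: sC; rewrite -bigcup2E; case: sB => s0 sC sU; apply: sU => i.
  rewrite /bigcup2; case: ifPn => _; first by rewrite -setTD; exact: sC.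
  by case: ifPn => _ //; rewrite -setTD; exact: sC.
rewrite -IH2; apply: (block_independence (L := \bigcup_(i < n) L i) (L' := L n)) => //.
rewrite setI_bigcupl; apply: bigcup0 => i /= ltin; apply: dL.
by move=> ein; rewrite ein ltnn in ltin.
Qed.

End independent_blocks.

(** * Hitting probabilities *)
Section expectation_on_nat.
Context (R : realType).
Implicit Types (p : probability nat R) (g h : nat -> R).

Lemma nat_integral p (g : nat -> \bar R) : (forall n, 0 <= g n) ->
  \int[p]_n g n = \sum_(0 <= n <oo) g n * p [set n].
Proof.
move=> g0.
have T : \bigcup_(k : nat) [set k] = [set: nat].
  by apply/seteqP; split => // k _; exists k.
rewrite -{1}T ge0_integral_bigcup //.
- apply: eq_eseriesr => n _.
  transitivity (\int[p]_(x in [set n]) (cst (g n)) x).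
    by apply: eq_integral => x; rewrite inE /= => ->.
  by rewrite integral_cst.
- by move=> i j _ _ [x [/= -> ->]].
Qed.

Lemma nat_bounded_integrable p g (M : R) :
  (forall n, `|g n| <= M)%R -> p.-integrable setT (EFin \o g).
Proof.
move=> gM; apply: measurable_bounded_integrable => //.
  by rewrite (le_lt_trans (probability_le1 p measurableT)) // ltry.
exists M; split; first exact: num_real.
by move=> x Mx n _ /=; rewrite (le_trans (gM n)) // ltW.
Qed.

Lemma unit_integrable p g : (forall n, 0 <= g n <= 1)%R ->
  p.-integrable setT (EFin \o g).
Proof.
move=> g01; apply: (@nat_bounded_integrable _ _ 1%R) => n.
by have /andP[g0 g1] := g01 n; rewrite ger0_norm.
Qed.

Lemma EFin_expect p g : p.-integrable setT (EFin \o g) ->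
  (\int[p]_n g n)%R%:E = \int[p]_n (g n)%:E.
Proof. by move=> ig; rewrite /Rintegral fineK //; exact: integrable_fin_num. Qed.

Lemma expect_cst p (c : R) : (\int[p]_n c)%R = c.
Proof.
rewrite (Rintegral_cst p measurableT c) -[RHS]mulr1; congr (_ * _)%R.
by rewrite -[RHS]/(fine 1); congr fine; exact: probability_setT.
Qed.

Lemma expect_unit p g : (forall n, 0 <= g n <= 1)%R ->
  (0 <= \int[p]_n g n <= 1)%R.
Proof.
move=> g01; rewrite Rintegral_ge0 /=; last by move=> n _; case/andP: (g01 n).
rewrite -[leRHS](expect_cst p 1); apply: le_Rintegral => //.
- exact: unit_integrable.
- by apply: unit_integrable => n; rewrite ler01 lexx.
- by move=> n _; case/andP: (g01 n).
Qed.

End expectation_on_nat.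

Section hitting_probabilities.
Context (R : realType) (p : probability nat R) (f : nat -> probability nat R).

(** The probability that a particle of generation [k] has, within [N] generations,
a descendant at height [z] above it, where a jump is [1 - j] with [j] of law [p].
A jump from distance [z'.+1] leaves the distance [z' + j], which is never
negative: jumps are at most 1, so the level cannot be overshot and distance 0
means that it has been reached. *)
Fixpoint hit (N k z : nat) : R :=
  match z, N with
  | 0%N, _ => 1%R
  | _.+1, 0%N => 0%R
  | z'.+1, N'.+1 =>
    (\int[f k]_n (1 - (1 - \int[p]_j hit N' k.+1 (z' + j)%N) ^+ n))%R
  end.

Lemma miss_pow_unit (s : R) n : (0 <= s <= 1)%R -> (0 <= 1 - (1 - s) ^+ n <= 1)%R.
Proof.
move=> /andP[s0 s1]; rewrite subr_ge0 exprn_ile1 ?subr_ge0 ?lerBlDr ?lerDl //.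
by rewrite exprn_ge0 ?subr_ge0.
Qed.

Lemma hit_unit N k z : (0 <= hit N k z <= 1)%R.
Proof.
elim: N k z => [|N IH] k [|z] /=; rewrite ?ler01 ?lexx //.
apply: expect_unit => n; apply: miss_pow_unit; exact: expect_unit.
Qed.

Lemma hit_mean_unit N k z : (0 <= \int[p]_j hit N k (z + j)%N <= 1)%R.
Proof. by apply: expect_unit => j; exact: hit_unit. Qed.

End hitting_probabilities.

Section steps.
Context (R : realType).

(** The jumps are integers at most 1, so a jump is coded by its defect, the natural
number [j] such that the jump is [1 - j]. *)
Definition defect (r : measurableTypeR R) : nat := Num.truncn (1 - r)%R.

Lemma defectE j : defect (1 - j%:R)%R = j.
Proof. by rewrite /defect opprB addrC subrK natrK. Qed.

Lemma measurable_fun_to_nat d (T : measurableType d) (h : T -> nat) :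
  (forall n, measurable (h @^-1` [set n])) -> measurable_fun setT h.
Proof.
move=> mh _ Y _; rewrite setTI.
have -> : h @^-1` Y = \bigcup_(n in Y) (h @^-1` [set n]).
  by apply/seteqP; split => [x Yx|x [n Yn /= ->]] //; exists (h x).
exact: bigcup_measurable.
Qed.

Lemma measurable_defect : measurable_fun setT defect.
Proof.
have m1 : measurable_fun setT (fun r : measurableTypeR R => 1 - r : R)%R.
  exact: measurable_funB.
have mge n : measurable [set r : measurableTypeR R | (n%:R <= 1 - r)%R].
  rewrite (_ : [set _ | _] = (fun r : measurableTypeR R => 1 - r : R)%R @^-1` `[n%:R, +oo[%classic).
    by rewrite -[X in measurable X]setTI; apply: m1.
  by apply/seteqP; split => r /=; rewrite in_itv /= andbT.
apply: measurable_fun_to_nat => -[|n].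
  rewrite (_ : _ @^-1` _ = ~` [set r | (1%:R <= 1 - r)%R]).
    by apply: measurableC; exact: mge.
  apply/seteqP; split => r /=; rewrite /defect.
    by move=> /truncn0Pn /negP.
  by move=> /negP /truncn0Pn.
rewrite (_ : _ @^-1` _ = [set r | (n.+1%:R <= 1 - r)%R] `\` [set r | (n.+2%:R <= 1 - r)%R]).
  by apply: measurableD; exact: mge.
apply/seteqP; split => r /=; rewrite /defect -!truncn_gt_nat.
  by move=> ->; rewrite ltnn ltnSn.
by move=> [h1 /negP]; rewrite -leqNgt => h2; apply/eqP; rewrite eqn_leq h1 h2.
Qed.

HB.instance Definition _ := @isMeasurableFun.Build _ _ _ _ defect measurable_defect.

Lemma measurable_bounded_jumps :
  measurable [set r : measurableTypeR R | r = (1 - (defect r)%:R)%R].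
Proof.
rewrite (_ : [set _ | _] = \bigcup_n [set (1 - n%:R)%R]).
  by apply: bigcup_measurable => n _; exact: measurable_set1.
apply/seteqP; split => r /=; first by move=> rE; exists (defect r).
by move=> [n _ /= ->]; rewrite defectE.
Qed.

Definition defect_law (mu : probability (measurableTypeR R) R) : probability nat R :=
  distribution mu defect.

Lemma defect_lawE mu A : defect_law mu A = mu (defect @^-1` A).
Proof. by []. Qed.

End steps.

Lemma measure_bigcupT d (T : measurableType d) (R : realType)
    (P : {measure set T -> \bar R}) (F : nat -> set T) :
  (forall n, measurable (F n)) -> trivIset setT F ->
  P (\bigcup_n F n) = \sum_(0 <= n <oo) P (F n).
Proof.
move=> mF tF; rewrite measure_bigcup //.
by apply: eq_eseriesl => n; rewrite in_setT.
Qed.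

Section block_closure.
Context d (T : measurableType d) (I : eqType) (G : I -> set_system T).
Implicit Types (L : set I).

Lemma block_bigcup L (A : nat -> set T) :
  (forall n, block_algebra G L (A n)) -> block_algebra G L (\bigcup_n A n).
Proof. by case: (block_algebra_sigma G L) => _ _ h; exact: h. Qed.

Lemma block_setC L A : block_algebra G L A -> block_algebra G L (~` A).
Proof. by rewrite -setTD; case: (block_algebra_sigma G L) => _ h _; exact: h. Qed.

Lemma block_set0 L : block_algebra G L set0.
Proof. by case: (block_algebra_sigma G L). Qed.

Lemma block_setT L : block_algebra G L setT.
Proof. by rewrite -setC0; apply: block_setC; exact: block_set0. Qed.

Lemma block_bigcap L (A : nat -> set T) :
  (forall n, block_algebra G L (A n)) -> block_algebra G L (\bigcap_n A n).
Proof.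
move=> LA; rewrite -[X in block_algebra _ _ X]setCK setC_bigcap.
by apply: block_setC; apply: block_bigcup => n; exact: block_setC.
Qed.

Lemma block_setI L A B : block_algebra G L A -> block_algebra G L B ->
  block_algebra G L (A `&` B).
Proof.
move=> LA LB; rewrite -bigcap2E; apply: block_bigcap => -[|[|n]] //=.
exact: block_setT.
Qed.

Lemma block_bigcap_ltn L (A : nat -> set T) n :
  (forall i, block_algebra G L (A i)) -> block_algebra G L (\bigcap_(i < n) A i).
Proof.
move=> LA; rewrite bigcap_mkcond; apply: block_bigcap => i.
by case: ifP => _ //; exact: block_setT.
Qed.

Lemma block_gen L i A : L i -> G i A -> block_algebra G L A.
Proof. by move=> Li GA; apply: sub_gen_smallest; exists i. Qed.

End block_closure.

(** * The event that a level is not reached *)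
Section subtrees.
Context (R : realType) (mu : probability (measurableTypeR R) R).
Context (F : int -> probability nat R) (B : brw mu F).
Local Notation T := (brw_space B).
Local Notation P := (brw_law B).
Let p := defect_law mu.
Let f k := F (Posz k.+1).

Definition defect_of (u : seq nat) (w : T) : nat := defect (displacement B u w).

(** Stated negatively because a level is missed when the subtrees of all children
miss it, which independence turns into a product. *)
Fixpoint nohit (N z : nat) (u : seq nat) : set T :=
  match z, N with
  | 0%N, _ => set0
  | _.+1, 0%N => setT
  | z'.+1, N'.+1 => [set w | forall i, (i < offspring B u w)%N ->
      nohit N' (z' + defect_of (rcons u i) w)%N (rcons u i) w]
  end.

Let G (v : seq nat + seq nat) : set_system T := match v with
  | inl u => preimage_set_system setT (offspring B u) measurable
  | inr u => preimage_set_system setT (displacement B u) measurable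
  end.

Let G_measurable v A : G v A -> measurable A.
Proof.
case: v => u /= [C mC <-]; rewrite setTI -[X in measurable X]setTI.
  exact: offspring_measurable.
exact: displacement_measurable.
Qed.

Let G_setI v : setI_closed (G v).
Proof.
by case: v => u /= _ _ [C mC <-] [D mD <-]; exists (C `&` D);
  rewrite ?preimage_setI ?setTI //; exact: measurableI.
Qed.

Let G_indep : mutual_independence P G.
Proof. exact: (@brw_independence _ _ _ B). Qed.

(** [below u] leaves out the displacement of [u] itself, which is then independent
of [nohit N z u]; [child_block u i] contains that of the child, on which
[child_nohit] depends through the remaining distance. *)
Definition below (u : seq nat) : set (seq nat + seq nat) :=
  [set v | match v with inl x => prefix u x | inr x => prefix u x && (x != u) end].

Definition child_block (u : seq nat) (i : nat) : set (seq nat + seq nat) :=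
  [set v | match v with inl x => prefix (rcons u i) x | inr x => prefix (rcons u i) x end].

Definition child_nohit N z u i : set T :=
  [set w | nohit N (z + defect_of (rcons u i) w)%N (rcons u i) w].

(** Conditioning on a jump, and on an offspring number in [nohitSE], is
replaced by a countable disjoint union over its values. *)
Lemma child_nohitE N z u i : child_nohit N z u i =
  \bigcup_j ([set w | defect_of (rcons u i) w = j] `&` nohit N (z + j)%N (rcons u i)).
Proof.
by apply/seteqP; split => [w hw|w [j _ [/= <-]]] //; exists (defect_of (rcons u i) w).
Qed.

Lemma nohitSE N z u : nohit N.+1 z.+1 u =
  \bigcup_n ([set w | offspring B u w = n] `&` \bigcap_(i < n) child_nohit N z u i).
Proof.
apply/seteqP; split => [w hw|w [n _ [/= <- hw]] i iu]; last exact: hw.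
by exists (offspring B u w).
Qed.

Lemma defect_block u j : G (inr u) [set w | defect_of u w = j].
Proof.
exists (@defect R @^-1` [set j]).
  by rewrite -[X in measurable X]setTI; exact: measurable_defect.
by rewrite setTI.
Qed.

Lemma offspring_block u n : G (inl u) [set w | offspring B u w = n].
Proof. by exists [set n] => //; rewrite setTI. Qed.

Lemma prefix_rcons_neq u i (x : seq nat) : prefix (rcons u i) x -> prefix u x /\ x != u.
Proof.
move=> h; split; first exact: prefix_trans (prefix_rcons u i) h.
apply/eqP => xu; move/prefixP: h => [s]; rewrite xu => /(congr1 size).
rewrite size_cat size_rcons => /eqP.
by rewrite -{1}[size u]addn0 addSnnS eqn_add2l.
Qed.

Lemma nohit_block N z u : block_algebra G (below u) (nohit N z u).
Proof.
elim: N z u => [|N IH] [|z] u;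
  [exact: block_set0|exact: block_setT|exact: block_set0|].
rewrite nohitSE; apply: block_bigcup => n; apply: block_setI.
  apply: block_gen (offspring_block u n); exact: prefix_refl.
apply: block_bigcap_ltn => i; rewrite child_nohitE; apply: block_bigcup => j.
apply: block_setI.
  apply: block_gen (defect_block _ j) => /=.
  by have [-> ->] := @prefix_rcons_neq u i (rcons u i) (prefix_refl _).
suff sub : below (rcons u i) `<=` below u.
  by apply: (sub_block_algebra sub); exact: IH.
move=> -[] x /=.
  by move=> /prefix_rcons_neq[].
by move=> /andP[/prefix_rcons_neq[-> ->]].
Qed.

Lemma child_nohit_block N z u i :
  block_algebra G (child_block u i) (child_nohit N z u i).
Proof.
rewrite child_nohitE; apply: block_bigcup => j; apply: block_setI.
  apply: block_gen (defect_block _ j); exact: prefix_refl.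
suff sub : below (rcons u i) `<=` child_block u i.
  by apply: (sub_block_algebra sub); exact: nohit_block.
by move=> -[] x //= /andP[].
Qed.

Lemma measurable_nohit N z u : measurable (nohit N z u).
Proof. apply: (block_algebra_measurable G_measurable (L := below u)).
exact: nohit_block. Qed.

Lemma child_block_disj u i j : i <> j -> child_block u i `&` child_block u j = set0.
Proof.
move=> ij; apply/seteqP; split => // v [hi hj]; apply: ij.
have {v hi hj} [x [/prefixP[s ->] /prefixP[t /eqP]]] :
    exists x : seq nat, prefix (rcons u i) x /\ prefix (rcons u j) x.
  by case: v hi hj => x /= hi hj; exists x.
by rewrite !cat_rcons eqseq_cat // => /andP[_ /eqP[]].
Qed.

(** The recursion for [hit] is the branching property: the offspring number is
independent of the subtrees of the children, these are independent of each other,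
and each jump is independent of the subtree below it. *)
Lemma probability_nohit N z u :
  P (nohit N z u) = (1 - hit p f N (size u) z)%:E.
Proof.
elim: N z u => [|N IH] [|z] u.
- by rewrite /= measure0 subrr.
- by rewrite /= probability_setT subr0.
- by rewrite /= measure0 subrr.
pose s := (\int[p]_j hit p f N (size u).+1 (z + j)%N)%R.
have mI i j : measurable ([set w | defect_of (rcons u i) w = j] `&`
                          nohit N (z + j)%N (rcons u i)).
  apply: measurableI; last exact: measurable_nohit.
  exact: G_measurable (defect_block _ _).
have Pchild i : P (child_nohit N z u i) = (1 - s)%:E.
  rewrite child_nohitE measure_bigcupT //; last first.
    by move=> j k _ _ [w [[/= <- _] [/= <-]]].
  transitivity (\int[p]_j (1 - hit p f N (size u).+1 (z + j)%N)%:E).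
    rewrite nat_integral; last first.
      by move=> j; rewrite lee_fin subr_ge0; case/andP: (hit_unit p f N (size u).+1 (z + j)).
    apply: eq_eseriesr => j _.
    transitivity (P [set w | defect_of (rcons u i) w = j] *
                  P (nohit N (z + j)%N (rcons u i))).
      apply: (block_independence G_measurable G_setI G_indep
        (L := [set inr (rcons u i)]) (L' := below (rcons u i))).
      - by apply/seteqP; split => // -[] x [/= [] // ->]; rewrite eqxx andbF.
      - exact: block_gen (defect_block _ _).
      - exact: nohit_block.
    rewrite IH size_rcons muleC; congr (_ * _).
    rewrite defect_lawE -(displacement_distribution B (rcons u i)) //.
    by rewrite -[X in measurable X]setTI; exact: measurable_defect.
  rewrite -EFin_expect; last first.
    apply: unit_integrable => j; rewrite subr_ge0 lerBlDr lerDl andbC.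
    by have /andP[-> ->] := hit_unit p f N (size u).+1 (z + j).
  rewrite RintegralB //; first by rewrite expect_cst.
  - by apply: unit_integrable => _; rewrite ler01 lexx.
  - by apply: unit_integrable => j; exact: hit_unit.
rewrite nohitSE measure_bigcupT //; last 2 first.
- move=> n; apply: measurableI; first exact: G_measurable (offspring_block _ _).
  apply: fin_bigcap_measurable => [|i _]; first exact: finite_II.
  apply: (block_algebra_measurable G_measurable (L := child_block u i)).
  exact: child_nohit_block.
- by move=> j k _ _ [w [[/= <- _] [/= <-]]].
have s01 : (0 <= s <= 1)%R by exact: hit_mean_unit.
transitivity (\int[f (size u)]_n ((1 - s) ^+ n)%:E).
  rewrite nat_integral; last first.
    by move=> n; rewrite lee_fin exprn_ge0 // subr_ge0; case/andP: s01.
  apply: eq_eseriesr => n _.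
  transitivity (P [set w | offspring B u w = n] *
                P (\bigcap_(i < n) child_nohit N z u i)).
    apply: (block_independence G_measurable G_setI G_indep
      (L := [set inl u]) (L' := \bigcup_i child_block u i)).
  - apply/seteqP; split => // -[] x [/= []// -> [i _ /=]].
    by move=> /prefix_rcons_neq[_]; rewrite eqxx.
  - exact: block_gen (offspring_block _ _).
  - apply: block_bigcap_ltn => i.
    suff sub : child_block u i `<=` \bigcup_i child_block u i.
      by apply: (sub_block_algebra sub); exact: child_nohit_block.
    exact: bigcup_sup.
  rewrite muleC; congr (_ * _); last first.
    by rewrite -(offspring_distribution B u [set n]).
  transitivity (\prod_(i < n) P (child_nohit N z u i)).
    apply: (block_independence_prod G_measurable G_setI G_indep (L := child_block u)).
    - exact: child_block_disj.
    - exact: child_nohit_block.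
  under eq_bigr do rewrite Pchild.
  by rewrite prodEFin prodr_const card_ord.
have [s0 s1] := andP s01.
rewrite -EFin_expect; last first.
  apply: unit_integrable => n; rewrite exprn_ge0 ?exprn_ile1 ?subr_ge0 ?lerBlDr ?lerDl //.
have -> : (1 - hit p f N.+1 (size u) z.+1 =
    \int[f (size u)]_n 1 - \int[f (size u)]_n (1 - (1 - s) ^+ n))%R.
  by rewrite expect_cst.
congr EFin; rewrite -RintegralB //.
- by apply: eq_Rintegral => n _; rewrite subKr.
- by apply: unit_integrable => _; rewrite ler01 lexx.
- by apply: unit_integrable => n; exact: miss_pow_unit.
Qed.

End subtrees.

(** * From lineages to the maximal displacement *)
Section lineages.
Context (R : realType) (mu : probability (measurableTypeR R) R).
Context (F : int -> probability nat R) (B : brw mu F).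
Local Notation T := (brw_space B).
Local Notation P := (brw_law B).
Let p := defect_law mu.
Let f k := F (Posz k.+1).

(** Forms of [born] and [position] suited to induction along a lineage [s] that
starts at an arbitrary individual [u]. *)
Fixpoint born_below (u s : seq nat) (w : T) : bool :=
  if s is i :: s' then (i < offspring B u w)%N && born_below (rcons u i) s' w
  else true.

Fixpoint climb (u s : seq nat) (w : T) : R :=
  (if s is i :: s' then (displacement B (rcons u i) w : R) + climb (rcons u i) s' w
   else 0)%R.

Lemma born_belowP u s w : reflect
  (forall j, (j < size s)%N -> (nth 0 s j < offspring B (u ++ take j s) w)%N)
  (born_below u s w).
Proof.
elim: s u => [|i s IH] u /=; first by apply: ReflectT.
apply: (iffP andP) => [[iu /IH h] [|j]|h]; rewrite ?cats0 //=.
  by rewrite ltnS => /h; rewrite cat_rcons.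
split; first by have := h 0%N isT; rewrite cats0.
by apply/IH => j js; rewrite cat_rcons; exact: (h j.+1).
Qed.

Lemma bornE w s : born w s = born_below [::] s w.
Proof.
apply/forallP/born_belowP => [h j js|h j]; last exact: h.
exact: (h (Ordinal js)).
Qed.

Lemma positionE w s : position w s = climb [::] s w.
Proof.
rewrite /position.
suff h u : (\sum_(j < size s) (displacement B (u ++ take j.+1 s) w : R))%R = climb u s w.
  exact: (h [::]).
elim: s u => [|i s IH] u; first by rewrite big_ord0.
rewrite big_ord_recl /= take0 cats1 -IH; congr (_ + _)%R.
by apply: eq_bigr => j _; rewrite -cat_rcons.
Qed.

(** On these sample points the coding of jumps by defects is exact for every
label. *)
Definition tame (w : T) : Prop :=
  forall u, displacement B u w = (1 - (defect_of u w)%:R)%R.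

(** Each step gains at most 1, so a lineage that ends at height [z] or above has
passed through [z]. *)
Lemma hit_of_climb w : tame w -> forall s N z u, born_below u s w ->
  (z%:R <= climb u s w)%R -> (size s <= N)%N -> ~ nohit N z u w.
Proof.
move=> tw; elim=> [|i s IH] N [|z] u; try by case: N => [|N] _ _ _ [].
  by rewrite /= lern0.
case: N => // N /= /andP[iu bs] zc sN /(_ i iu); apply: IH => //.
rewrite natrD; move: zc; rewrite tw -natr1; lra.
Qed.

Lemma climb_of_hit w : tame w -> forall N z u, ~ nohit N z u w ->
  exists2 s, born_below u s w & (z%:R <= climb u s w)%R.
Proof.
move=> tw; elim=> [|N IH] [|z] u //= h; try by exists [::].
have [i /not_implyP[iu /IH[s bs sz]]] : exists i, ~ ((i < offspring B u w)%N ->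
    nohit N (z + defect_of (rcons u i) w)%N (rcons u i) w).
  by apply/existsNP.
exists (i :: s) => /=; first by rewrite iu.
by move: sz; rewrite tw natrD -natr1; lra.
Qed.

Lemma climb_int w : tame w -> forall s u, exists t : int, climb u s w = t%:~R.
Proof.
move=> tw; elim=> [|i s IH] u /=; first by exists 0%R.
have [t ->] := IH (rcons u i).
exists (1 - (defect_of (rcons u i) w)%:Z + t)%R.
by rewrite tw !rmorphD rmorphN /= rmorph1.
Qed.

Lemma max_displacement_ge w N z (x : R) : tame w -> ~ nohit N z [::] w ->
  (x <= z%:R)%R -> x%:E <= max_displacement w.
Proof.
move=> tw /(climb_of_hit tw)[s bs zs] xz.
apply: (@le_trans _ _ (position w s)%:E).
  by rewrite lee_fin positionE; exact: le_trans zs.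
by apply: ereal_sup_ubound; exists s => //=; rewrite bornE.
Qed.

(** Positions are integers, so a lineage above [z - 1] is at [z] at least; this also
covers a supremum that is not attained. *)
Lemma hit_of_max_displacement w z (x : R) : tame w -> x%:E <= max_displacement w ->
  (z%:R - 1 < x)%R -> exists N, ~ nohit N z [::] w.
Proof.
move=> tw xM zx.
have : (z%:R - 1)%:E < max_displacement w by apply: lt_le_trans xM; rewrite lte_fin.
move=> /ereal_sup_gt[_ [s bs <-]]; rewrite lte_fin positionE => zs.
exists (size s); apply: (hit_of_climb tw (s := s)) => //; first by rewrite -bornE.
move: zs; have [t ->] := climb_int tw s [::].
rewrite -[z%:R]/((z%:Z)%:~R : R)%R -[1%R]/(1%:~R : R)%R -rmorphB /= ltr_int ler_int.
lia.
Qed.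

Lemma nohit_mono N z u w : nohit N.+1 z u w -> @nohit R mu F B N z u w.
Proof.
elim: N z u => [|N IH] [|z] u //= h i iu.
exact/IH/h.
Qed.

Lemma measurable_born s : measurable [set w : T | born w s].
Proof.
rewrite (_ : [set _ | _] = \bigcap_(j < size s)
    (offspring B (take j s) @^-1` [set n | (nth 0 s j < n)%N])).
  apply: fin_bigcap_measurable => [|j _]; first exact: finite_II.
  by rewrite -[X in measurable X]setTI; exact: (offspring_measurable (take j s)).
apply/seteqP; split => w /=; rewrite bornE.
  by move=> /born_belowP h j /=; exact: h.
by move=> h; apply/born_belowP => j; exact: h.
Qed.

Lemma measurable_position s : measurable_fun setT (fun w : T => position w s).
Proof.
apply: measurable_sum => j; exact: displacement_measurable.
Qed.

Lemma measurable_max_displacement_gt (x : R) :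
  measurable [set w : T | x%:E < max_displacement w].
Proof.
rewrite (_ : [set _ | _] = \bigcup_s ([set w | born w s] `&` [set w : T | (x < position w s)%R])).
  apply: countable_bigcupT_measurable => [|s]; first exact: countableP.
  apply: measurableI.
    exact: measurable_born.
  rewrite -[X in measurable X]setTI.
  have := @measurable_position s measurableT `]x, +oo[%classic (measurable_itv _).
  congr (measurable (_ `&` _)).
  by apply/seteqP; split => w /=; rewrite in_itv /= andbT.
apply/seteqP; split => w /=.
  by move=> /ereal_sup_gt[_ [s bs <-]]; rewrite lte_fin; exists s.
move=> [s _ [bs xs]]; apply: (@lt_le_trans _ _ (position w s)%:E).
  by rewrite lte_fin.
by apply: ereal_sup_ubound; exists s.
Qed.

Lemma measurable_max_displacement_ge (x : R) :
  measurable [set w : T | x%:E <= max_displacement w].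
Proof.
rewrite (_ : [set _ | _] = \bigcap_n [set w : T | (x - n.+1%:R^-1)%:E < max_displacement w]).
  apply: bigcapT_measurable => n; exact: measurable_max_displacement_gt.
apply/seteqP; split => w /=.
  move=> h n _; apply: lt_le_trans h.
  by rewrite lte_fin ltrBlDr ltrDl invr_gt0.
move=> h; rewrite leNgt; apply/negP.
have := h 0%N I; rewrite /=; case E : (max_displacement w) => [r| |] // _.
rewrite lte_fin => /ltr_add_invr[n]; have /= := h n I.
rewrite E lte_fin ltrBlDr => h1 /(lt_trans h1).
by rewrite ltxx.
Qed.

Hypothesis mu_integral : mu [set r : measurableTypeR R | r = (1 - (defect r)%:R)%R] = 1.

Lemma tame_ae : P.-negligible (~` [set w | tame w]).
Proof.
pose bad n := if unpickle n is Some u then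
  displacement B u @^-1` ~` [set r : measurableTypeR R | r = (1 - (defect r)%:R)%R] else set0.
apply: (@negligibleS _ _ _ P (\bigcup_n bad n)); last first.
  apply: negligible_bigcup => n; rewrite /bad; case: unpickle => [u|]; last exact: negligible_set0.
  have mC := measurableC (@measurable_bounded_jumps R).
  apply/negligibleP.
    by rewrite -[X in measurable X]setTI; exact: displacement_measurable.
  transitivity (mu (~` [set r : measurableTypeR R | r = (1 - (defect r)%:R)%R])).
    exact: (displacement_distribution B u).
  rewrite probability_setC; last exact: measurable_bounded_jumps.
  by rewrite mu_integral subee.
move=> w /= /existsNP[u hu]; exists (pickle u) => //.
by rewrite /bad pickleK.
Qed.

Lemma quenched_tail_ge N z (x : R) : (x <= z%:R)%R ->
  (hit p f N 0 z)%:E <= quenched_tail B x.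
Proof.
move=> xz; have [A [mA A0 sA]] := tame_ae.
have -> : (hit p f N 0 z)%:E = P (~` nohit N z [::]).
  rewrite probability_setC ?probability_nohit; last exact: measurable_nohit.
  by rewrite /= -EFinB subKr.
apply: (@le_trans _ _ (P ([set w | x%:E <= max_displacement w] `|` A))).
  apply: le_measure; rewrite ?inE.
  - by apply: measurableC; exact: measurable_nohit.
  - by apply: measurableU => //; exact: measurable_max_displacement_ge.
  move=> w hw; have [tw|tw] := pselect (tame w); last by right; exact: sA.
  by left; exact: max_displacement_ge tw hw xz.
apply: (@le_trans _ _ (P [set w | x%:E <= max_displacement w] + P A)).
  by apply: measureU2 => //; exact: measurable_max_displacement_ge.
by rewrite A0 adde0.
Qed.

(** The event that the level is reached within [N] generations increases with [N],
so a bound uniform in [N] passes to the limit. *)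
Lemma quenched_tail_le z (x c : R) : (z%:R - 1 < x)%R ->
  (forall N, hit p f N 0 z <= c)%R -> quenched_tail B x <= c%:E.
Proof.
move=> zx hc; have [A [mA A0 sA]] := tame_ae.
pose H N := ~` @nohit R mu F B N z [::].
have mH N : measurable (H N) by apply: measurableC; exact: measurable_nohit.
have mUH : measurable (\bigcup_N H N) by exact: bigcup_measurable.
apply: (@le_trans _ _ (P (\bigcup_N H N `|` A))).
  apply: le_measure; rewrite ?inE.
  - exact: measurable_max_displacement_ge.
  - exact: measurableU.
  move=> w hw; have [tw|tw] := pselect (tame w); last by right; exact: sA.
  by left; have [N hN] := hit_of_max_displacement tw hw zx; exists N.
apply: (@le_trans _ _ (P (\bigcup_N H N) + P A)); first exact: measureU2.
rewrite A0 adde0.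
have cv : P \o H @ \oo --> P (\bigcup_N H N).
  apply: nondecreasing_cvg_mu => //; apply/nondecreasing_seqP => n.
  by apply/subsetPset => w hw /nohit_mono.
rewrite -(cvg_lim _ cv) //; apply: lime_le; first by apply/cvg_ex; eexists; exact: cv.
apply: nearW => N /=.
rewrite probability_setC ?probability_nohit; last exact: measurable_nohit.
by rewrite /= -EFinB subKr lee_fin.
Qed.

End lineages.

(** * One generation: two bounds on the generating function *)
Section generating_function.
Local Open Scope ring_scope.
Context (R : realType).
Implicit Types (F : probability nat R) (s t m b : R).

Lemma bernoulli_miss s n : 0 <= s <= 1 -> 1 - n%:R * s <= (1 - s) ^+ n.
Proof.
move=> /andP[s0 s1]; elim: n => [|n IH]; first by rewrite expr0 mul0r subr0.
rewrite exprS -natr1.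
have h : (1 - s) * (1 - n%:R * s) <= (1 - s) * (1 - s) ^+ n.
  by rewrite ler_wpM2l // subr_ge0.
apply: le_trans h; have n0 : 0 <= n%:R :> R by [].
nra.
Qed.

Lemma miss_hyperbolic s n : 0 <= s <= 1 -> (1 - s) ^+ n * (1 + n%:R * s) <= 1.
Proof.
move=> /andP[s0 s1]; elim: n => [|n IH]; first by rewrite expr0 mul0r addr0 mulr1.
rewrite exprSr -mulrA; apply: le_trans IH; apply: ler_wpM2l.
  by rewrite exprn_ge0 // subr_ge0.
rewrite -natr1; have n0 : 0 <= n%:R :> R by [].
nra.
Qed.

(** A second-moment bound for the number [Z] of marks when each of [n] children is
marked with probability [s]: the indicator of [Z > 0] is at least
[2 t Z - t ^ 2 Z ^ 2], and the first two moments of [Z] are [n s] and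
[n s + n (n - 1) s ^ 2]. *)
Lemma miss_second_moment s t n : 0 <= s <= 1 ->
  2 * t * s * n%:R - t ^+ 2 * (s * n%:R + s ^+ 2 * (n * n.-1)%:R) <=
  1 - (1 - s) ^+ n.
Proof.
move=> s01; have /andP[s0 s1] := s01.
case: n => [|n]; first by rewrite mul0n !mulr0 addr0 !mulr0 expr0 !subrr.
rewrite [n.+1.-1]/=; pose A := 1 + n%:R * s.
have A0 : 0 < A by rewrite ltr_pwDl // mulr_ge0.
have h1 : (1 - s) ^+ n.+1 <= (1 - s) / A.
  rewrite exprS; apply: ler_wpM2l; first by rewrite subr_ge0.
  by rewrite -[leRHS]mul1r ler_pdivlMr //; exact: miss_hyperbolic.
have h2 : 1 - (1 - s) / A = n.+1%:R * s / A.
  rewrite -[X in X - _](divff (lt0r_neq0 A0)) -mulrBl; congr (_ / _).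
  by rewrite /A -natr1; ring.
have h3 : 2 * t - t ^+ 2 * A <= A^-1.
  rewrite -subr_ge0.
  have -> : A^-1 - (2 * t - t ^+ 2 * A) = A * (t - A^-1) ^+ 2.
    by field; exact: lt0r_neq0.
  by rewrite mulr_ge0 ?sqr_ge0 // ltW.
apply: (@le_trans _ _ (n.+1%:R * s / A)); last by rewrite -h2 lerD2l lerN2.
have -> : 2 * t * s * n.+1%:R - t ^+ 2 * (s * n.+1%:R + s ^+ 2 * (n.+1 * n)%:R) =
    n.+1%:R * s * (2 * t - t ^+ 2 * A) by rewrite natrM /A; ring.
by apply: ler_wpM2l h3; rewrite mulr_ge0.
Qed.

Lemma nneg_integrable F (g : nat -> R) r : (forall n, 0 <= g n) ->
  (\int[F]_n (g n)%:E = r%:E)%E -> F.-integrable setT (EFin \o g).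
Proof.
move=> g0 gr; apply/integrableP; split => //.
under eq_integral do rewrite /= ger0_norm //.
by rewrite gr ltry.
Qed.

Lemma miss_pow_integrable F s : 0 <= s <= 1 ->
  F.-integrable setT (EFin \o (fun n => 1 - (1 - s) ^+ n)).
Proof. by move=> s01; apply: unit_integrable => n; exact: miss_pow_unit. Qed.

Lemma hit_by_mean F s m : 0 <= s <= 1 ->
  (\int[F]_n (n%:R)%:E = m%:E)%E ->
  \int[F]_n (1 - (1 - s) ^+ n) <= m * s.
Proof.
move=> s01 Fm.
have iF : F.-integrable setT (EFin \o (fun n => n%:R : R)).
  by apply: nneg_integrable Fm.
have -> : m * s = \int[F]_n (n%:R * s).
  by rewrite RintegralZr // /Rintegral Fm.
apply: le_Rintegral => //.
- exact: miss_pow_integrable.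
- under [_ \o _]eq_fun => n do rewrite /= mulrC EFinM.
  exact: (integrableZl measurableT).
- by move=> n _; rewrite lerBlDr -lerBlDl bernoulli_miss.
Qed.

(** [miss_second_moment] integrated over [n], for the optimal
[t = 1 / (1 + b m ^ - 2 (m s))]. The loss with respect to the mean [m s] involves
only the normalised moment [b / m ^ 2] and [m s] itself. *)
Lemma hit_by_second_moment F s m b : 0 <= s <= 1 -> 0 < m ->
  (\int[F]_n (n%:R)%:E = m%:E)%E ->
  (\int[F]_n ((n * n.-1)%:R)%:E = b%:E)%E ->
  m * s / (1 + b / m ^+ 2 * (m * s)) <= \int[F]_n (1 - (1 - s) ^+ n).
Proof.
move=> s01 m0 Fm Fb.
have iF : F.-integrable setT (EFin \o (fun n => n%:R : R)).
  by apply: nneg_integrable Fm.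
have iG : F.-integrable setT (EFin \o (fun n => (n * n.-1)%:R : R)).
  by apply: nneg_integrable Fb.
have b0 : 0 <= b by rewrite -lee_fin -Fb; apply: integral_ge0.
have /andP[s0 s1] := s01.
pose D := 1 + b / m ^+ 2 * (m * s).
have D0 : 0 < D by rewrite ltr_pwDl // !mulr_ge0 // ?invr_ge0 ?exprn_ge0 ?ltW.
pose t := D^-1.
pose c1 := 2 * t * s - t ^+ 2 * s.
pose c2 := - (t ^+ 2 * s ^+ 2).
have i1 : F.-integrable setT (EFin \o (fun n => c1 * n%:R)).
  under [_ \o _]eq_fun => n do rewrite /= EFinM.
  exact: (integrableZl measurableT).
have i2 : F.-integrable setT (EFin \o (fun n => c2 * (n * n.-1)%:R)).
  under [_ \o _]eq_fun => n do rewrite /= EFinM.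
  exact: (integrableZl measurableT).
have -> : m * s / D = \int[F]_n (c1 * n%:R + c2 * (n * n.-1)%:R).
  rewrite RintegralD // !RintegralZl // /Rintegral Fm Fb /= /c1 /c2 /t.
  have bE : b = (D - 1) * (m ^+ 2 / (m * s)) \/ s = 0.
    have [->|sn0] := eqVneq s 0; [by right|left].
    by rewrite /D; field; rewrite sn0 lt0r_neq0.
  case: bE => [bE|->]; last by rewrite !(mulr0, mul0r, subr0, addr0, expr0n, oppr0).
  have [->|sn0] := eqVneq s 0; first by rewrite !(mulr0, mul0r, subr0, addr0, expr0n, oppr0).
  rewrite bE; field; by rewrite sn0 !lt0r_neq0.
apply: le_Rintegral => //.
- under [_ \o _]eq_fun => n do rewrite /= EFinD.
  exact: (integrableD measurableT i1 i2).
- exact: miss_pow_integrable.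
- move=> n _; apply: le_trans (miss_second_moment t n s01).
  by rewrite le_eqVlt; apply/orP; left; apply/eqP; rewrite /c1 /c2; ring.
Qed.

End generating_function.

(** * Solving the recursion for the hitting probabilities *)
Section recursion_bounds.
Local Open Scope ring_scope.
Context (R : realType) (p : probability nat R) (f : nat -> probability nat R).
Context (m b : nat -> R).
Hypothesis m_gt0 : forall k, 0 < m k.
Hypothesis f_mean : forall k, (\int[f k]_n (n%:R)%:E = (m k)%:E)%E.
Hypothesis f_fact : forall k, (\int[f k]_n ((n * n.-1)%:R)%:E = (b k)%:E)%E.
Local Notation hit := (hit p f).

(** The expected size of generation [k]. *)
Definition prod_mean k := \prod_(i < k) m i.
Definition eta k := b k / m k ^+ 2.

Lemma prod_mean_gt0 k : 0 < prod_mean k.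
Proof. exact: prodr_gt0. Qed.

Lemma prod_meanS k : prod_mean k.+1 = prod_mean k * m k.
Proof. exact: big_ord_recr. Qed.

Lemma eta_ge0 k : 0 <= eta k.
Proof.
have b0 : 0 <= b k by rewrite -lee_fin -f_fact; exact: integral_ge0.
by rewrite divr_ge0 // exprn_ge0 // ltW.
Qed.

Definition jump_mgf (lambda : R) := \int[p]_j expR (lambda * (1 - j%:R)).

Lemma expR_shift_integrable lambda z : 0 <= lambda ->
  p.-integrable setT (EFin \o (fun j => expR (- lambda * (z + j)%:R))).
Proof.
move=> l0; apply: unit_integrable => j; rewrite expR_ge0 /=.
by rewrite -expR0 ler_expR mulNr oppr_le0 mulr_ge0.
Qed.

Lemma expect_expR_shift lambda z : 0 <= lambda ->
  \int[p]_j expR (- lambda * (z + j)%:R) = expR (- lambda * z.+1%:R) * jump_mgf lambda.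
Proof.
move=> l0; rewrite -RintegralZl //.
  apply: eq_Rintegral => j _; rewrite -expRD; congr expR.
  by rewrite natrD -natr1; ring.
have := integrableZl measurableT (expR lambda) (expR_shift_integrable 0 l0).
apply: eq_integrable => // j _; rewrite /= -EFinM -expRD; congr (expR _)%:E.
by rewrite add0n; ring.
Qed.

Lemma mean_hit_integrable N k z :
  p.-integrable setT (EFin \o (fun j => hit N k (z + j)%N)).
Proof. by apply: unit_integrable => j; exact: hit_unit. Qed.

(** The first-moment bound: [e ^ (- lambda z)] is a supersolution of the linearised
recursion as soon as one generation multiplies the expected exponential weight of
the population by at most 1. *)
Lemma hit_upper (a eps C lambda : R) : 0 <= lambda ->
  (forall k, prod_mean k <= expR (C + (a + eps) * k%:R)) ->
  expR (a + eps) * jump_mgf lambda <= 1 ->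
  forall N k z,
  prod_mean k * hit N k z <= expR (C + (a + eps) * k%:R) * expR (- lambda * z%:R).
Proof.
move=> l0 hA hphi; elim=> [|N IH] k [|z] /=.
- by rewrite mulr0 expR0 !mulr1.
- by rewrite mulr0 mulr_ge0 // expR_ge0.
- by rewrite mulr0 expR0 !mulr1.
have := hit_mean_unit p f N k.+1 z; set s := Rintegral _ _ _ => s01.
apply: (@le_trans _ _ (prod_mean k.+1 * s)).
  rewrite prod_meanS -mulrA; apply: ler_wpM2l; first exact/ltW/prod_mean_gt0.
  exact: hit_by_mean.
rewrite /s -RintegralZl //; last exact: mean_hit_integrable.
apply: (@le_trans _ _ (\int[p]_j (expR (C + (a + eps) * k.+1%:R) *
    expR (- lambda * (z + j)%:R)))).
  apply: le_Rintegral => //.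
  - under [_ \o _]eq_fun => n do rewrite /= EFinM.
    apply: (integrableZl measurableT); exact: mean_hit_integrable.
  - under [_ \o _]eq_fun => n do rewrite /= EFinM.
    apply: (integrableZl measurableT); exact: expR_shift_integrable.
rewrite RintegralZl //; last exact: expR_shift_integrable.
rewrite expect_expR_shift // -[k.+1%:R]natr1 mulrDr mulr1 addrA (expRD (C + _)) -mulrA.
apply: ler_wpM2l; first exact: expR_ge0.
rewrite mulrCA -[leRHS]mulr1; apply: ler_wpM2l => //; exact: expR_ge0.
Qed.

(** The linearisation of [hit]: the expected number of descendants at height [z],
within [N] generations, none of whose ancestors has reached that height. *)
Fixpoint expected_hits (N k z : nat) : R :=
  match z, N with
  | 0%N, _ => 1
  | _.+1, 0%N => 0
  | z'.+1, N'.+1 => m k * \int[p]_j expected_hits N' k.+1 (z' + j)%N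
  end.

Lemma expected_hits_bounded N k :
  exists M : R, forall z, 0 <= expected_hits N k z <= M.
Proof.
elim: N k => [|N IH] k.
  by exists 1 => -[|z] /=; rewrite ?lexx ?ler01.
have [M hM] := IH k.+1.
have M0 : 0 <= M by have /andP[] := hM 0%N; exact: le_trans.
exists (1 + m k * M) => -[|z] /=.
  by rewrite ler01 lerDl mulr_ge0 // ltW.
have i0 : 0 <= \int[p]_j expected_hits N k.+1 (z + j)%N.
  by apply: Rintegral_ge0 => j _; case/andP: (hM (z + j)%N).
have mk0 : 0 <= m k by exact: ltW.
rewrite mulr_ge0 //=; apply: (@le_trans _ _ (m k * M)); last by rewrite lerDr.
apply: ler_wpM2l => //.
rewrite -[leRHS](expect_cst p M); apply: le_Rintegral => //.
- apply: (@nat_bounded_integrable _ _ _ M) => j.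
  by have /andP[h1 h2] := hM (z + j)%N; rewrite ger0_norm.
- by apply: (@nat_bounded_integrable _ _ _ M) => j; rewrite ger0_norm.
- by move=> j _; case/andP: (hM (z + j)%N).
Qed.

Lemma expected_hits_ge0 N k z : 0 <= expected_hits N k z.
Proof. by have [M /(_ z)/andP[]] := expected_hits_bounded N k. Qed.

Lemma expected_hits_integrable N k z :
  p.-integrable setT (EFin \o (fun j => expected_hits N k (z + j)%N)).
Proof.
have [M hM] := expected_hits_bounded N k.
apply: (@nat_bounded_integrable _ _ _ M) => j.
by have /andP[h1 h2] := hM (z + j)%N; rewrite ger0_norm.
Qed.

(** Over a fixed horizon [T] the fluctuations [eps k] of the log-means are all
replaced by [eps T], which leaves exact exponentials [e ^ (a k)] in the
recursions. *)
Section horizon.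
Context (a eps C : R) (T : nat).
Hypothesis a_le0 : a <= 0.
Hypothesis eps_ge0 : 0 <= eps.
Hypothesis prod_mean_le : forall k, (k <= T)%N ->
  prod_mean k <= expR (C + (a + eps) * k%:R).
Hypothesis prod_mean_ge : forall k, (k <= T)%N ->
  expR (- C + (a - eps) * k%:R) <= prod_mean k.

Lemma eps_le_horizon k : (k <= T)%N -> eps * k%:R <= eps * T%:R.
Proof. by move=> kT; rewrite ler_wpM2l // ler_nat. Qed.

Lemma prod_mean_le_horizon k : (k <= T)%N ->
  prod_mean k <= expR (C + eps * T%:R + a * k%:R).
Proof.
move=> kT; apply: le_trans (prod_mean_le kT) _; rewrite ler_expR.
by have := eps_le_horizon kT; lra.
Qed.

Lemma prod_mean_ge_horizon k : (k <= T)%N ->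
  expR (- C - eps * T%:R + a * k%:R) <= prod_mean k.
Proof.
move=> kT; apply: le_trans (prod_mean_ge kT); rewrite ler_expR.
by have := eps_le_horizon kT; lra.
Qed.

(** Constants are supersolutions of the linearised recursion, as the expected
population does not grow when [a <= 0]. *)
Lemma expected_hits_le N k z : (N + k = T)%N ->
  prod_mean k * expected_hits N k z <= expR (C + eps * T%:R + a * k%:R).
Proof.
elim: N k z => [|N IH] k [|z] NkT /=; rewrite ?mulr1 ?mulr0 ?expR_ge0 //.
- by apply: prod_mean_le_horizon; rewrite -NkT.
- by apply: prod_mean_le_horizon; rewrite -NkT leq_addl.
rewrite mulrA -prod_meanS -RintegralZl //; last exact: expected_hits_integrable.
apply: (@le_trans _ _ (\int[p]_j expR (C + eps * T%:R + a * k.+1%:R))).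
  apply: le_Rintegral => //.
  - under [_ \o _]eq_fun => n do rewrite /= EFinM.
    apply: (integrableZl measurableT); exact: expected_hits_integrable.
  - apply: (@nat_bounded_integrable _ _ _ (expR (C + eps * T%:R + a * k.+1%:R))) => j.
    by rewrite ger0_norm // expR_ge0.
  - by move=> j _; apply: IH; rewrite addnS -addSn.
by rewrite expect_cst ler_expR lerD2l -natr1 mulrDr mulr1 gerDl.
Qed.

Lemma expected_hits_bound N k z : (N + k = T)%N ->
  expected_hits N k z <= expR (2 * C + 2 * eps * T%:R).
Proof.
move=> NkT; have kT : (k <= T)%N by rewrite -NkT leq_addl.
have h := expected_hits_le z NkT.
have := prod_mean_ge_horizon kT; set e := expR _ => he.
have e0 : 0 < e by exact: expR_gt0.
rewrite -(ler_pM2l e0); apply: (@le_trans _ _ (prod_mean k * expected_hits N k z)).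
  by rewrite ler_wpM2r // expected_hits_ge0.
apply: le_trans h _; rewrite /e -expRD ler_expR; lra.
Qed.

(** At the root [lambda] of the hypothesis, [e ^ (- lambda z)] solves the linearised
recursion with mean factor [e ^ a]. At the horizon it differs from
[expected_hits] by at most 1, and going back one generation multiplies this error
by [e ^ a]. *)
Lemma expected_hits_ge lambda N k z : 0 <= lambda ->
  jump_mgf lambda = expR (- a) -> (N + k = T)%N ->
  expR (- C - eps * T%:R + a * k%:R) * (expR (- lambda * z%:R) - expR (a * N%:R)) <=
  prod_mean k * expected_hits N k z.
Proof.
move=> l0 hl; elim: N k z => [|N IH] k [|z] NkT.
- have kT : (k <= T)%N by rewrite -NkT.
  rewrite [expected_hits _ _ _]/= mulr0 expR0 mulr0 expR0 subrr mulr0 mulr1.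
  exact/ltW/prod_mean_gt0.
- rewrite [expected_hits _ _ _]/= !mulr0 expR0 mulr_ge0_le0 ?expR_ge0 // subr_le0.
  by rewrite -expR0 ler_expR mulNr oppr_le0 mulr_ge0.
- have kT : (k <= T)%N by rewrite -NkT leq_addl.
  rewrite [expected_hits _ _ _]/= mulr0 expR0 mulr1.
  apply: le_trans (prod_mean_ge_horizon kT); rewrite -[leRHS]mulr1 ler_wpM2l ?expR_ge0 //.
rewrite [expected_hits _ _ _]/= mulrA -prod_meanS -RintegralZl //;
  last exact: expected_hits_integrable.
have NkT' : (N + k.+1 = T)%N by rewrite addnS -addSn.
set c := - C - eps * T%:R.
have iE : p.-integrable setT (EFin \o (fun j => expR (- lambda * (z + j)%:R) - expR (a * N%:R))).
  under [_ \o _]eq_fun => n do rewrite /= EFinB.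
  apply: integrableB => //; first exact: expR_shift_integrable.
  apply: (@nat_bounded_integrable _ _ _ (expR (a * N%:R))) => j.
  by rewrite ger0_norm // expR_ge0.
apply: (@le_trans _ _ (\int[p]_j (expR (c + a * k.+1%:R) *
   (expR (- lambda * (z + j)%:R) - expR (a * N%:R))))).
  rewrite RintegralZl // RintegralB //; last 2 first.
  - exact: expR_shift_integrable.
  - apply: (@nat_bounded_integrable _ _ _ (expR (a * N%:R))) => j.
    by rewrite ger0_norm // expR_ge0.
  rewrite expect_cst expect_expR_shift // hl.
  have -> : c + a * k.+1%:R = c + a * k%:R + a by rewrite -natr1; ring.
  rewrite (expRD (c + _)) -mulrA.
  rewrite le_eqVlt; apply/orP; left; apply/eqP; congr (_ * _).
  rewrite mulrBr mulrCA -expRD subrr expR0 mulr1 -expRD -natr1; congr (_ - expR _).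
  by ring.
apply: le_Rintegral => //.
- under [_ \o _]eq_fun => n do rewrite /= EFinM.
  exact: (integrableZl measurableT).
- under [_ \o _]eq_fun => n do rewrite /= EFinM.
  apply: (integrableZl measurableT); exact: expected_hits_integrable.
- by move=> j _; exact: IH.
Qed.

(** Backward induction over the generations. In generation [k],
[hit_by_second_moment] costs the factor [1 + eta k * (m k * s)]; since the expected
number of hits is at most [D], it increases the constant in the comparison by at
most [D * eta k], so the losses add up instead of being multiplied. *)
Lemma hit_ge_expected D : 0 <= D ->
  (forall N k z, (N + k = T)%N -> expected_hits N k z <= D) ->
  forall N k z, (N + k = T)%N ->
  expected_hits N k z <= (1 + D * \sum_(k <= i < T) eta i) * hit N k z.
Proof.
move=> D0 hD; elim=> [|N IH] k [|z] NkT.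
- by rewrite /= mulr1 lerDl mulr_ge0 // sumr_ge0 // => i _; exact: eta_ge0.
- by rewrite /= mulr0.
- by rewrite /= mulr1 lerDl mulr_ge0 // sumr_ge0 // => i _; exact: eta_ge0.
have NkT' : (N + k.+1 = T)%N by rewrite addnS -addSn.
have kT : (k < T)%N by rewrite -NkT' leq_addl.
have hw := hD _ k z.+1 NkT.
rewrite [hit _ _ _]/=; set s := Rintegral p _ _.
have s01 : 0 <= s <= 1 by exact: hit_mean_unit.
set c' := 1 + D * \sum_(k.+1 <= i < T) eta i.
have c'1 : 1 <= c'.
  by rewrite lerDl mulr_ge0 // sumr_ge0 // => i _; exact: eta_ge0.
have -> : 1 + D * \sum_(k <= i < T) eta i = c' + D * eta k.
  by rewrite big_ltn // /c'; ring.
set w := expected_hits _ _ _; have w0 : 0 <= w by exact: expected_hits_ge0.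
have eta0 := eta_ge0 k.
have hs : w <= c' * (m k * s).
  rewrite mulrCA /w /=; apply: ler_wpM2l; first exact: ltW.
  rewrite /s -RintegralZl //; last exact: mean_hit_integrable.
  apply: le_Rintegral => //.
  - exact: expected_hits_integrable.
  - under [_ \o _]eq_fun => n do rewrite /= EFinM.
    apply: (integrableZl measurableT); exact: mean_hit_integrable.
  - by move=> j _; exact: IH.
have h := hit_by_second_moment s01 (m_gt0 k) (f_mean k) (f_fact k).
rewrite -[b k / _]/(eta k) in h.
apply: (@le_trans _ _ ((c' + D * eta k) * (m k * s / (1 + eta k * (m k * s))))); last first.
  apply: ler_wpM2l h; apply: addr_ge0; first exact: le_trans ler01 c'1.
  exact: mulr_ge0.
have q0 : 0 <= m k * s by case/andP: s01 => ? _; apply: mulr_ge0 => //; exact: ltW.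
set q := m k * s in hs q0 *.
have d0 : 0 < 1 + eta k * q by rewrite ltr_pwDl // mulr_ge0.
rewrite mulrA ler_pdivlMr //.
have : w * (eta k * q) <= D * (eta k * q) by rewrite ler_wpM2r // mulr_ge0.
lra.
Qed.

End horizon.

Lemma hit_lower (a eps C lambda : R) (T z : nat) : a <= 0 -> 0 <= eps ->
  (forall k, (k <= T)%N ->
    expR (- C + (a - eps) * k%:R) <= prod_mean k <= expR (C + (a + eps) * k%:R)) ->
  0 <= lambda -> jump_mgf lambda = expR (- a) ->
  expR (- C - eps * T%:R) * (expR (- lambda * z%:R) - expR (a * T%:R)) <=
  (1 + expR (2 * C + 2 * eps * T%:R) * \sum_(0 <= i < T) eta i) * hit T 0 z.
Proof.
move=> a0 e0 hA l0 hl.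
have hA1 k : (k <= T)%N -> prod_mean k <= expR (C + (a + eps) * k%:R).
  by move=> /hA /andP[].
have hA2 k : (k <= T)%N -> expR (- C + (a - eps) * k%:R) <= prod_mean k.
  by move=> /hA /andP[].
have h1 := expected_hits_ge e0 hA2 z l0 hl (addn0 T).
rewrite mulr0 addr0 /prod_mean big_ord0 mul1r in h1.
apply: le_trans h1 _; apply: (hit_ge_expected (expR_ge0 _)); last exact: addn0.
by move=> N k z' NkT; exact: (expected_hits_bound a0 e0 hA1 hA2).
Qed.

End recursion_bounds.

(** * The jump law and its exponential moments *)
Section jump_law.
Context (R : realType) (mu : probability (measurableTypeR R) R).
Hypothesis mu_hyp : jump_law_hyp mu.
Local Notation p := (defect_law mu).

(** An integer below 2 is [1 - j] for some natural number [j]. *)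
Lemma jump_law_bounded :
  mu [set r : measurableTypeR R | r = (1 - (defect r)%:R)%R] = 1.
Proof.
have [hZ _ h2 _ _] := mu_hyp.
have mZ : measurable (range (fun z : int => z%:~R : R) : set (measurableTypeR R)).
  rewrite (_ : range _ = \bigcup_(z : int) [set z%:~R : R]).
    apply: countable_bigcupT_measurable => [|z]; first exact: countableP.
    exact: measurable_set1.
  by apply/seteqP; split => [_ [z _ <-]|_ [z _ ->]]; exists z.
have mge2 : measurable [set y : measurableTypeR R | (2 <= y)%R].
  rewrite (_ : [set _ | _] = `[2%R, +oo[%classic); first exact: measurable_itv.
  by apply/seteqP; split => y /=; rewrite in_itv /= andbT.
apply/eqP; rewrite eq_le probability_le1; last exact: measurable_bounded_jumps.
rewrite -hZ /=.
apply: (@le_trans _ _ (mu ([set r : measurableTypeR R | r = (1 - (defect r)%:R)%R] `|`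
                           [set y : measurableTypeR R | (2 <= y)%R]))).
  apply: le_measure; rewrite ?inE //.
    by apply: measurableU => //; exact: measurable_bounded_jumps.
  move=> _ [z _ <-] /=; have [z2|z2] := leP (2 : int)%R z.
    by right; rewrite (_ : 2%R = (2 : int)%:~R)%R // ler_int.
  left; have [j zj] : exists j : nat, z = (1 - j%:Z)%R.
    by exists `|1 - z|%N; lia.
  have -> : z%:~R = (1 - j%:R)%R :> R by rewrite zj rmorphB.
  by rewrite defectE.
apply: (@le_trans _ _ (mu [set r : measurableTypeR R | r = (1 - (defect r)%:R)%R] +
                       mu [set y : measurableTypeR R | (2 <= y)%R])).
  by apply: measureU2 => //; exact: measurable_bounded_jumps.
by rewrite h2 adde0.
Qed.

Lemma jump_ae : {ae mu, forall r : measurableTypeR R, r = (1 - (defect r)%:R)%R}.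
Proof.
exists (~` [set r : measurableTypeR R | r = (1 - (defect r)%:R)%R]); split => //.
  by apply: measurableC; exact: measurable_bounded_jumps.
rewrite probability_setC ?jump_law_bounded ?subee //.
exact: measurable_bounded_jumps.
Qed.

Lemma ge0_integral_jump (g : R -> R) : measurable_fun setT g -> (forall y, 0 <= g y)%R ->
  \int[mu]_y (g y)%:E = \int[p]_j (g (1 - j%:R)%R)%:E.
Proof.
move=> mg g0; rewrite ge0_integral_distribution //; last by move=> j; rewrite lee_fin.
apply: ge0_ae_eq_integral => //.
- exact/measurable_EFinP.
- apply: (measurableT_comp (f := fun j : nat => (g (1 - j%:R)%R)%:E)) => //.
- by move=> y _; rewrite lee_fin.
- by move=> y _; rewrite lee_fin.
apply: filterS jump_ae => y /= yE _; congr EFin; congr g; exact: yE.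
Qed.

Lemma abs_jump_integrable :
  p.-integrable setT (EFin \o (fun j => `|1 - j%:R|%R)).
Proof.
have [_ _ _ /integrableP[_ hi] _] := mu_hyp.
apply/integrableP; split => //.
under eq_integral do rewrite /= normr_id.
rewrite -(ge0_integral_jump (g := fun y => `|y|%R)) //.
Qed.

(** Otherwise the jump is almost surely nonpositive; as it is centred, its law is
the point mass at 0. *)
Lemma defect0_gt0 : 0 < p [set 0%N].
Proof.
have [_ hnt _ hi h0] := mu_hyp.
rewrite lt_def measure_ge0 andbT; apply/negP => /eqP p0.
apply: hnt; exists 0%R.
have mI := measurable_int _ hi.
have ae_pos : {ae mu, forall r : measurableTypeR R, defect r <> 0%N}.
  exists (@defect R @^-1` [set 0%N]); split => //.
  - by rewrite -[X in measurable X]setTI; exact: measurable_defect.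
  - by move=> r /= /contrapT.
have ae_neg : ae_eq mu setT (fun y : measurableTypeR R => `|(y : R)%:E|)
                            (fun y => - (y : R)%:E).
  apply: filterS2 jump_ae ae_pos => y yE y0 _; rewrite -EFinN /=; congr EFin.
  rewrite ler0_norm // [X in (X <= _)%R]yE subr_le0.
  by rewrite ler1n lt0n; exact/eqP.
have : \int[mu]_(y in setT) `|(y : R)%:E| = 0.
  rewrite (ae_eq_integral (fun y : measurableTypeR R => - (y : R)%:E)) //.
  - by rewrite integralN ?h0 ?oppe0 //; exact: integrable_add_def.
  - exact: measurableT_comp.
  - exact: measurableT_comp.
move=> /(ae_eq_integral_abs mu measurableT mI)[A [mA A0 sA]].
apply/eqP; rewrite eq_le probability_le1 //=.
have <- : mu (~` A) = 1 by rewrite probability_setC // A0 sube0.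
apply: le_measure; rewrite ?inE //; first exact: measurableC.
move=> y /= Ay; apply/eqP/negPn/negP => y0; apply: Ay; apply: sA => /= h.
by have [/eqP] := h I; rewrite (negPf y0).
Qed.

Local Open Scope ring_scope.

Lemma expR_jump_integrable lambda : 0 <= lambda ->
  p.-integrable setT (EFin \o (fun j => expR (lambda * (1 - j%:R)))).
Proof.
move=> l0; apply: (@nat_bounded_integrable _ _ _ (expR lambda)) => j.
by rewrite ger0_norm ?expR_ge0 // ler_expR ler_piMr // gerBl.
Qed.

Lemma jump_mgf0 : jump_mgf p 0 = 1.
Proof.
rewrite /jump_mgf -[RHS](expect_cst p 1); apply: eq_Rintegral => j _.
by rewrite mul0r expR0.
Qed.

Lemma jump_mgf_ge lambda : 0 <= lambda ->
  fine (p [set 0%N]) * expR lambda <= jump_mgf p lambda.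
Proof.
move=> l0.
have -> : fine (p [set 0%N]) * expR lambda = \int[p]_j (\1_[set 0%N] j * expR lambda).
  rewrite RintegralZr //; first by rewrite /Rintegral integral_indic // setIT.
  exact: integrable_indic.
apply: le_Rintegral => //.
- apply: (@nat_bounded_integrable _ _ _ (expR lambda)) => j.
  rewrite ger0_norm ?mulr_ge0 ?expR_ge0 // ler_piMl ?expR_ge0 //.
- exact: expR_jump_integrable.
- move=> [|j] _; rewrite indicE.
    by rewrite mem_set // mul1r subr0 mulr1.
  by rewrite memNset // mul0r expR_ge0.
Qed.

Lemma jump_mgf_gt0 lambda : 0 <= lambda -> 0 < jump_mgf p lambda.
Proof.
move=> l0; apply: lt_le_trans (jump_mgf_ge l0).
rewrite mulr_gt0 ?expR_gt0 // fine_gt0 // defect0_gt0 /=.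
exact: (le_lt_trans (probability_le1 p _) (ltry 1)).
Qed.

Lemma Lambda_s_jump_mgf lambda : 0 <= lambda ->
  Lambda_s mu lambda = (ln (jump_mgf p lambda))%:E.
Proof.
move=> l0; rewrite /Lambda_s (ge0_integral_jump (g := fun y => expR (lambda * y))).
- rewrite -EFin_expect; last exact: expR_jump_integrable.
  by rewrite lne_EFin // jump_mgf_gt0.
- by apply: measurableT_comp => //; exact: mulrl_measurable.
- by move=> y; exact: expR_ge0.
Qed.

Lemma expR_sub_le (u v : R) : expR u - expR v <= expR u * (u - v).
Proof.
have := expR_ge1Dx (v - u); rewrite -(ler_pM2l (expR_gt0 u)) -expRD.
have -> : u + (v - u) = v by ring.
lra.
Qed.

(** As jumps are at most 1, [e ^ L] bounds the exponentials that occur, and the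
first moment of the jump controls their variation. *)
Lemma jump_mgf_lipschitz L l1 l2 : 0 <= l1 <= L -> 0 <= l2 <= L ->
  `|jump_mgf p l1 - jump_mgf p l2| <=
  `|l1 - l2| * (expR L * \int[p]_j `|1 - j%:R|).
Proof.
move=> /andP[l10 l1L] /andP[l20 l2L].
have i1 := expR_jump_integrable l10; have i2 := expR_jump_integrable l20.
have key l l' j : 0 <= l <= L ->
    expR (l * (1 - j%:R)) - expR (l' * (1 - j%:R)) <=
    `|l - l'| * (expR L * `|1 - j%:R|) :> R.
  move=> /andP[l0 lL]; apply: le_trans (expR_sub_le _ _) _.
  rewrite -mulrBl; apply: le_trans (ler_norm _) _; rewrite !normrM mulrCA.
  rewrite ler_wpM2l // ler_wpM2r // ger0_norm ?expR_ge0 // ler_expR.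
  by apply: le_trans lL; rewrite ler_piMr // gerBl.
rewrite /jump_mgf -RintegralB // -RintegralZl //; last exact: abs_jump_integrable.
have iA : p.-integrable setT (EFin \o (fun j => expR L * `|1 - j%:R|)).
  under [_ \o _]eq_fun => n do rewrite /= EFinM.
  by apply: (integrableZl measurableT); exact: abs_jump_integrable.
rewrite -RintegralZl //.
have iB : p.-integrable setT (EFin \o
    (fun j => expR (l1 * (1 - j%:R)) - expR (l2 * (1 - j%:R)))).
  by under [_ \o _]eq_fun => n do rewrite /= EFinB; exact: integrableB.
apply: le_trans (le_normr_Rintegral _ iB) _ => //.
apply: le_Rintegral => //.
- exact: integrable_norm.
- under [_ \o _]eq_fun => n do rewrite /= EFinM.
  exact: (integrableZl measurableT).
move=> j _; rewrite ler_norml; apply/andP; split; last by rewrite key // l10.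
by rewrite lerNl opprB distrC key // l20.
Qed.

Lemma jump_mgf_convex t lambda : 0 <= t <= 1 -> 0 <= lambda ->
  jump_mgf p (t * lambda) <= (1 - t) + t * jump_mgf p lambda.
Proof.
move=> /andP[t0 t1] l0.
have -> : (1 - t) + t * jump_mgf p lambda =
    \int[p]_j ((1 - t) + t * expR (lambda * (1 - j%:R))).
  rewrite RintegralD //.
  - by rewrite expect_cst RintegralZl //; exact: expR_jump_integrable.
  - by apply: (@nat_bounded_integrable _ _ _ (`|1 - t|)).
  - under [_ \o _]eq_fun => n do rewrite /= EFinM.
    by apply: (integrableZl measurableT); exact: expR_jump_integrable.
apply: le_Rintegral => //.
- by apply: expR_jump_integrable; rewrite mulr_ge0.
- under [_ \o _]eq_fun => n do rewrite /= EFinD EFinM.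
  apply: integrableD => //.
    by apply: (@nat_bounded_integrable _ _ _ (`|1 - t|)).
  by apply: (integrableZl measurableT); exact: expR_jump_integrable.
move=> j _; rewrite -mulrA; set y := lambda * _.
have e1 : expR (t * y) * (1 - t * y) <= 1.
  have := expR_ge1Dx (- (t * y)); rewrite -(ler_pM2l (expR_gt0 (t * y))) -expRD.
  by rewrite subrr expR0.
have e2 : expR (t * y) * (1 + (1 - t) * y) <= expR y.
  have := expR_ge1Dx ((1 - t) * y); rewrite -(ler_pM2l (expR_gt0 (t * y))) -expRD.
  by have -> : t * y + (1 - t) * y = y by ring.
have := ler_wpM2l t0 e2; have : 0 <= 1 - t by rewrite subr_ge0.
move=> /ler_wpM2l/(_ _ _ e1); lra.
Qed.

(** The transform is convex and equal to 1 at 0, so before [l2] it stays below a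
value at [l2] that exceeds 1. *)
Lemma jump_mgf_lt l1 l2 : 0 <= l1 < l2 -> 1 < jump_mgf p l2 ->
  jump_mgf p l1 < jump_mgf p l2.
Proof.
move=> /andP[l10 l12] c1; have l20 : 0 < l2 by exact: le_lt_trans l12.
have t01 : 0 <= l1 / l2 <= 1.
  by rewrite divr_ge0 //= ?ler_pdivrMr ?mul1r //; exact: ltW.
have := jump_mgf_convex t01 (ltW l20); rewrite divfK ?lt0r_neq0 //.
move=> /le_lt_trans; apply.
have t1 : l1 / l2 < 1 by rewrite ltr_pdivrMr // mul1r.
nra.
Qed.

(** The transform may be infinite at negative arguments; outside [0] to [L] it is
extended by constants, to which the intermediate value theorem applies. *)
Lemma jump_mgf_continuous_clamp L : 0 <= L ->
  continuous (fun l : R => jump_mgf p (Num.min L (Num.max 0 l))).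
Proof.
move=> L0 x.
pose K := expR L * \int[p]_j `|1 - j%:R| + 1.
have I0 : 0 <= \int[p]_j `|1 - j%:R| :> R by apply: Rintegral_ge0.
have K0 : 0 < K by rewrite ltr_wpDl // mulr_ge0 // expR_ge0.
pose c (l : R) := Num.min L (Num.max 0 l).
have c01 l : 0 <= c l <= L by rewrite /c ge_min lexx le_min L0 le_max lexx.
have cL l l' : `|c l - c l'| <= `|l - l'|.
  have h1 := ler_norm (l - l'); have := ler_norm (l' - l); rewrite distrC => h2.
  rewrite /c; case: (leP 0 l) => ?; case: (leP 0 l') => ?;
  rewrite ?(min_r L0) //; do ?case: (leP L _) => ?;
  rewrite ler_norml; apply/andP; split; lra.
apply/cvgrPdist_le => e e0.
have eK : 0 < e / K by rewrite divr_gt0.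
near=> y.
apply: (le_trans (jump_mgf_lipschitz (c01 x) (c01 y))).
apply: (@le_trans _ _ (`|x - y| * K)).
  apply: ler_pM => //; first by rewrite mulr_ge0 // expR_ge0.
  by rewrite lerDl.
by rewrite -ler_pdivlMr.
Unshelve. all: by end_near.
Qed.

(** The transform is 1 at 0 and at least [p_0 e ^ lambda], where [p_0 > 0] is the
probability of a jump by 1. *)
Lemma jump_mgf_root delta : 0 < delta ->
  exists2 lambda, 0 < lambda & jump_mgf p lambda = expR delta.
Proof.
move=> d0; set p0 := fine (p [set 0%N]).
have p00 : 0 < p0.
  rewrite fine_gt0 // defect0_gt0 /=.
  exact: (le_lt_trans (probability_le1 p _) (ltry 1)).
have p01 : p0 <= 1.
  rewrite -lee_fin fineK ?probability_le1 // ge0_fin_numE //.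
  exact: (le_lt_trans (probability_le1 p _) (ltry 1)).
pose L := delta - ln p0.
have L0 : 0 <= L by have := ln_le0 p01; rewrite /L; lra.
have hL : expR delta <= jump_mgf p L.
  apply: le_trans (jump_mgf_ge L0); rewrite -/p0 -{1}(lnK (x := p0)) ?posrE //.
  by rewrite -expRD ler_expR /L; lra.
have d1 : 1 < expR delta by rewrite -expR0 ltr_expR.
have [l] : exists2 l, l \in `[0, L] &
    jump_mgf p (Num.min L (Num.max 0 l)) = expR delta.
  apply: IVT => //.
    by apply: continuous_subspaceT; exact: jump_mgf_continuous_clamp.
  rewrite (max_l (lexx 0)) (min_r L0) (max_r L0) (min_l (lexx L)) jump_mgf0.
  by rewrite ge_min le_max hL (ltW d1) orbT.
rewrite in_itv /= => /andP[l0 lL]; rewrite (max_r l0) (min_r lL) => hl.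
exists l => //; rewrite lt_def l0 andbT; apply/negP => /eqP l00.
by move: d1; rewrite -hl l00 jump_mgf0 ltxx.
Qed.

Lemma jump_mgf_root_unique delta l1 l2 : 0 < delta -> 0 < l1 -> 0 < l2 ->
  jump_mgf p l1 = expR delta -> jump_mgf p l2 = expR delta -> l1 = l2.
Proof.
move=> d0 l10 l20 h1 h2; have d1 : 1 < expR delta by rewrite -expR0 ltr_expR.
case: (ltgtP l1 l2) => // [l12|l21].
- have : jump_mgf p l1 < jump_mgf p l2 by apply: jump_mgf_lt; rewrite ?l12 ?ltW ?h2.
  by rewrite h1 h2 ltxx.
- have : jump_mgf p l2 < jump_mgf p l1 by apply: jump_mgf_lt; rewrite ?l21 ?ltW ?h1.
  by rewrite h1 h2 ltxx.
Qed.

Lemma Lambda_s_eq lambda delta : 0 <= lambda ->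
  Lambda_s mu lambda = delta%:E <-> jump_mgf p lambda = expR delta.
Proof.
move=> l0; rewrite Lambda_s_jump_mgf //; split => [[<-]|->].
  by rewrite lnK // posrE jump_mgf_gt0.
by rewrite expRK.
Qed.

Lemma kappa_unique delta : 0 < delta ->
  unique (fun lambda : R => 0 < lambda /\ Lambda_s mu lambda = delta%:E) (kappa mu delta).
Proof.
move=> d0.
have [l l0 hl] := jump_mgf_root d0.
have S : [set lambda : R | 0 < lambda /\ Lambda_s mu lambda = delta%:E] l.
  by split => //; apply/(Lambda_s_eq _ (ltW l0)).
have [k0 hk] := @xgetPex _ 0 [set lambda : R | 0 < lambda /\
   Lambda_s mu lambda = delta%:E] (ex_intro _ l S).
split=> // l' [l'0 /(Lambda_s_eq _ (ltW l'0)) hl'].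
apply: (jump_mgf_root_unique d0 k0 l'0 _ hl').
exact/(Lambda_s_eq _ (ltW k0)).
Qed.

End jump_law.

(** * Averages along geometric subsequences *)
Section truncation_series.
Context (R : realType).
Local Open Scope ring_scope.
Implicit Types (y t alpha : R).

Lemma min_sq_telescope alpha y t : 1 < alpha -> 0 <= y -> 0 < t ->
  Num.min y t ^+ 2 / t <=
  4 * alpha / (alpha - 1) * (alpha * t * y / (alpha * t + y) - t * y / (t + y)).
Proof.
move=> al1 y0 t0; set v := Num.min y t.
have al0 : 0 < alpha by exact: lt_trans al1.
have d1 : 0 < alpha * t + y by rewrite ltr_wpDr // mulr_gt0.
have d2 : 0 < t + y by rewrite ltr_wpDr.
have d3 : 0 < alpha - 1 by rewrite subr_gt0.
have v0 : 0 <= v by rewrite le_min y0 ltW.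
have hv : v * (t + y) <= 2 * (y * t).
  by rewrite /v; case: (leP y t) => h; nra.
have hv2 : v ^+ 2 * (t + y) ^+ 2 <= 4 * (y ^+ 2 * t ^+ 2).
  have := ler_pM (mulr_ge0 v0 (ltW d2)) (mulr_ge0 v0 (ltW d2)) hv hv.
  by rewrite !expr2; lra.
have -> : 4 * alpha / (alpha - 1) * (alpha * t * y / (alpha * t + y) - t * y / (t + y)) =
    4 * alpha * (y ^+ 2 * t) / ((alpha * t + y) * (t + y)).
  by field; rewrite !lt0r_neq0.
rewrite ler_pdivrMr // mulrAC ler_pdivlMr ?mulr_gt0 //.
have h3 : (alpha * t + y) * (t + y) <= alpha * (t + y) ^+ 2.
  rewrite expr2 mulrA; apply: ler_wpM2r; first exact: ltW.
  by rewrite mulrDr lerD2l ler_peMl // ltW.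
apply: (@le_trans _ _ (v ^+ 2 * (alpha * (t + y) ^+ 2))).
  by rewrite ler_wpM2l // exprn_ge0.
have := ler_wpM2l (ltW al0) hv2; lra.
Qed.

(** The truncation levels grow geometrically, so only those comparable to [y]
contribute. By [min_sq_telescope] each summand is at most a multiple of the
increment of [t y / (t + y)] between two successive levels [t]. *)
Lemma sum_min_sq_le alpha y J : 1 < alpha -> 0 <= y ->
  \sum_(j < J) Num.min y (alpha ^+ j) ^+ 2 / alpha ^+ j <= 4 * alpha / (alpha - 1) * y.
Proof.
move=> al1 y0.
have al0 : 0 < alpha by exact: lt_trans al1.
have c0 : 0 <= 4 * alpha / (alpha - 1).
  by rewrite divr_ge0 ?subr_ge0 ?mulr_ge0 // ltW.
have h : \sum_(j < J) Num.min y (alpha ^+ j) ^+ 2 / alpha ^+ j <=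
    4 * alpha / (alpha - 1) * (alpha ^+ J * y / (alpha ^+ J + y) - 1 * y / (1 + y)).
  elim: J => [|J IH]; first by rewrite big_ord0 expr0 subrr mulr0.
  rewrite big_ord_recr /=.
  have := min_sq_telescope al1 y0 (exprn_gt0 J al0); rewrite -exprS.
  move: IH; lra.
apply: le_trans h _; rewrite ler_wpM2l // lerBlDr.
apply: ler_wpDr; first by rewrite divr_ge0 ?mul1r // addr_ge0.
have aJ : 0 < alpha ^+ J by exact: exprn_gt0.
rewrite ler_pdivrMr ?ltr_wpDr // mulrDr mulrC lerDl mulr_ge0 //.
Qed.

Lemma geometric_floor alpha n : 1 < alpha -> (0 < n)%N ->
  exists j : nat, alpha ^+ j <= n%:R < alpha ^+ j.+1.
Proof.
move=> al1 n0.
have al0 : 0 < alpha by exact: lt_trans al1.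
have bern j : 1 + j%:R * (alpha - 1) <= alpha ^+ j.
  elim: j => [|j IH]; first by rewrite mul0r addr0 expr0.
  rewrite exprS; have := ler_wpM2l (ltW al0) IH.
  have : 0 <= j%:R * (alpha - 1) ^+ 2 by rewrite mulr_ge0 // sqr_ge0.
  by rewrite -natr1 expr2; lra.
have b j : alpha ^+ j <= n%:R -> (j <= Num.truncn (n%:R / (alpha - 1)))%N.
  have d0 : 0 <= n%:R / (alpha - 1) by rewrite divr_ge0 // subr_ge0 ltW.
  move=> h; rewrite truncn_ge_nat //.
  by rewrite ler_pdivlMr ?subr_gt0 //; have := bern j; lra.
have ex : exists j, alpha ^+ j <= n%:R by exists 0%N; rewrite expr0 ler1n.
case: (ex_maxnP ex b) => j hj jmax; exists j; rewrite hj ltNge /=.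
by apply/negP => /jmax; rewrite ltnn.
Qed.

Lemma truncn_half t : 1 <= t -> t / 2 <= (Num.truncn t)%:R <= t.
Proof.
move=> t1; have t0 : 0 <= t by exact: le_trans t1.
have /andP[h1 h2] := truncn_itv t0.
have h3 : 1 <= (Num.truncn t)%:R :> R by rewrite ler1n truncn_gt0.
by rewrite h1 andbT; move: h2; rewrite -natr1; lra.
Qed.

End truncation_series.

Section deterministic_lln.
Context (R : realType).
Local Open Scope ring_scope.

(** Partial sums of nonnegative terms increase, so between consecutive indices of a
geometric subsequence of ratio [alpha] the averages change by a factor of about
[alpha]; the ratios [1 + 1 / i] come arbitrarily close to 1. *)
Lemma interpolate_averages (y : nat -> R) (m : R) : (forall k, 0 <= y k) -> 0 <= m ->
  (forall i : nat, let alpha : R := 1 + i.+1%:R^-1 in forall delta : R, 0 < delta ->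
    exists J : nat, forall j, (J <= j)%N ->
      `|\sum_(k < Num.truncn (alpha ^+ j)) y k - (Num.truncn (alpha ^+ j))%:R * m| <=
      delta * (Num.truncn (alpha ^+ j))%:R) ->
  forall eps : R, 0 < eps -> exists C : R, forall n : nat,
    `|\sum_(k < n) y k - n%:R * m| <= C + eps * n%:R.
Proof.
move=> y0 m0 H eps eps0.
have [i hi] : exists i : nat, i.+1%:R^-1 * (m + 1) <= eps / 4.
  exists (Num.truncn ((m + 1) / (eps / 4))).
  have m1 : 0 < m + 1 by rewrite ltr_wpDl.
  rewrite mulrC ler_pdivrMr // mulrC -ler_pdivrMr ?divr_gt0 //.
  exact/ltW/truncnS_gt.
set beta : R := i.+1%:R^-1 in hi.
have beta0 : 0 < beta by rewrite invr_gt0.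
have beta1 : beta <= 1 by rewrite invf_le1 // ler1n.
pose delta := eps / 8.
have delta0 : 0 < delta by rewrite divr_gt0.
have := H i _ delta0; rewrite -/beta; set alpha := 1 + beta => -[J hJ].
have al1 : 1 < alpha by rewrite ltrDl.
have al0 : 0 < alpha by exact: lt_trans al1.
pose S n := \sum_(k < n) y k.
have S_mono n n' : (n <= n')%N -> S n <= S n'.
  move=> nn'; rewrite /S -!(big_mkord xpredT y) (big_cat_nat (leq0n n) nn') //=.
  by rewrite lerDl sumr_ge0.
have S0 n : 0 <= S n by exact: sumr_ge0.
pose N0 := (Num.truncn (alpha ^+ J)).+1.
have N00 n : n%:R < alpha ^+ J -> (n <= N0)%N.
  by move=> h; apply: ltnW; rewrite -(ltr_nat R); apply: lt_trans h _; exact: truncnS_gt.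
exists (S N0 + N0%:R * m + m) => n.
have en0 : 0 <= eps * n%:R by rewrite mulr_ge0 // ltW.
have [nJ|nJ] := ltP (n%:R : R) (alpha ^+ J).
  have := S_mono _ _ (N00 _ nJ); have := S0 n.
  have : n%:R * m <= N0%:R * m by rewrite ler_wpM2r // ler_nat N00.
  have : 0 <= n%:R * m by rewrite mulr_ge0.
  rewrite -/(S n) ler_norml => h1 h2 h3 h4; apply/andP; split; lra.
have n0 : (0 < n)%N.
  by rewrite -(ltr_nat R); apply: lt_le_trans nJ; exact: exprn_gt0.
have [j /andP[jn nj]] := geometric_floor al1 n0.
have Jj : (J <= j)%N.
  rewrite -ltnS -(ltr_eXn2l al1); exact: le_lt_trans nJ nj.
have aj1 k : 1 <= alpha ^+ k by rewrite exprn_ege1 // ltW.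
have aj0 k : 0 <= alpha ^+ k by exact: le_trans (aj1 k).
have := hJ _ Jj; have := hJ _ (leqW Jj).
set a := Num.truncn (alpha ^+ j); set b := Num.truncn (alpha ^+ j.+1).
rewrite -/(S a) -/(S b) !ler_norml => /andP[_ hb] /andP[ha _].
have an : (a <= n)%N.
  by rewrite -(ler_nat R); apply: le_trans jn; case/andP: (truncn_itv (aj0 j)).
have nb : (n <= b)%N by rewrite truncn_ge_nat // ltW.
have ba : b%:R <= alpha * n%:R :> R.
  have /andP[+ _] := truncn_itv (aj0 j.+1); move/le_trans; apply.
  by rewrite exprS ler_wpM2l // ltW.
have aa : n%:R <= alpha * (a%:R + 1) :> R.
  apply: ltW; apply: lt_le_trans nj _; rewrite exprS ler_wpM2l ?ltW //.
  by have /andP[_] := truncn_itv (aj0 j); rewrite natr1.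
have Sa := S_mono _ _ an; have Sb := S_mono _ _ nb.
have nR0 : 0 <= n%:R :> R by [].
have aR0 : 0 <= a%:R :> R by [].
have anR : a%:R <= n%:R :> R by rewrite ler_nat.
have mb : n%:R * (beta * m) <= n%:R * (eps / 4).
  rewrite ler_wpM2l //; apply: le_trans hi; rewrite ler_wpM2l ?ltW //; lra.
have N0m : 0 <= S N0 + N0%:R * m by rewrite addr_ge0 // mulr_ge0.
rewrite /delta in ha hb.
apply/andP; split.
  (* [a] is [n] up to the factor [alpha] and a rounding error, and
     1 / alpha >= 1 - beta *)
  have a_ge : n%:R * (1 - beta) - 1 <= a%:R.
    have : n%:R * (1 - beta) <= a%:R + 1.
      apply: (@le_trans _ _ (alpha * (a%:R + 1) * (1 - beta))).
        by rewrite ler_wpM2r // subr_ge0.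
      have -> : alpha * (a%:R + 1) * (1 - beta) = (a%:R + 1) - (a%:R + 1) * beta ^+ 2.
        by rewrite /alpha; ring.
      by rewrite gerBl mulr_ge0 ?sqr_ge0 // addr_ge0.
    lra.
  have := ler_wpM2r m0 a_ge.
  have : eps / 8 * a%:R <= eps / 8 * n%:R by rewrite ler_wpM2l // ltW.
  rewrite -/(S n); lra.
have h1 : b%:R * (m + eps / 8) <= alpha * n%:R * (m + eps / 8).
  by rewrite ler_wpM2r // addr_ge0 // ltW.
have h2 : n%:R * (beta * (eps / 8)) <= n%:R * (eps / 8).
  by rewrite ler_wpM2l // ler_piMl // ltW.
move: h1; rewrite /alpha -/(S n); lra.
Qed.

End deterministic_lln.

(** * The strong law of large numbers *)
Section bounded_variables.
Context d (T : measurableType d) (R : realType) (P : probability T R).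
Implicit Types f g : T -> R.
Local Open Scope ring_scope.

Definition bounded_rv f := measurable_fun setT f /\ exists M, forall w, `|f w| <= M.

Lemma bounded_rv_integrable f : bounded_rv f -> P.-integrable setT (EFin \o f).
Proof.
move=> [mf [M hM]]; apply: measurable_bounded_integrable => //.
  by rewrite (le_lt_trans (probability_le1 P measurableT)) // ltry.
exists M; split; first exact: num_real.
by move=> x Mx n _ /=; rewrite (le_trans (hM n)) // ltW.
Qed.

Lemma bounded_rv_cst c : bounded_rv (fun=> c).
Proof. by split => //; exists `|c|. Qed.

Lemma bounded_rvD f g : bounded_rv f -> bounded_rv g -> bounded_rv (fun w => f w + g w).
Proof.
move=> [mf [M hM]] [mg [N hN]]; split; first exact: measurable_funD.
exists (M + N) => w; apply: le_trans (ler_normD _ _) _; exact: lerD.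
Qed.

Lemma bounded_rvM f g : bounded_rv f -> bounded_rv g -> bounded_rv (fun w => f w * g w).
Proof.
move=> [mf [M hM]] [mg [N hN]]; split; first exact: measurable_funM.
by exists (M * N) => w; rewrite normrM ler_pM.
Qed.

Lemma bounded_rv_sum (F : nat -> T -> R) n : (forall k, bounded_rv (F k)) ->
  bounded_rv (fun w => \sum_(k < n) F k w).
Proof.
move=> bF; elim: n => [|n IH].
  under eq_fun do rewrite big_ord0; exact: bounded_rv_cst.
by under eq_fun do rewrite big_ord_recr /=; exact: bounded_rvD.
Qed.

Local Notation E f := (\int[P]_w f w).

Lemma mean_cst c : E (fun=> c) = c :> R.
Proof.
rewrite (Rintegral_cst P measurableT c) -[RHS]mulr1; congr (_ * _).
by rewrite -[RHS]/(fine 1%E); congr fine; exact: probability_setT.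
Qed.

Lemma meanD f g : bounded_rv f -> bounded_rv g -> E (fun w => f w + g w) = E f + E g.
Proof. by move=> bf bg; rewrite RintegralD //; exact: bounded_rv_integrable. Qed.

Lemma meanZ c f : bounded_rv f -> E (fun w => c * f w) = c * E f.
Proof. by move=> bf; rewrite RintegralZl //; exact: bounded_rv_integrable. Qed.

Lemma mean_le f g : P.-integrable setT (EFin \o f) -> P.-integrable setT (EFin \o g) ->
  (forall w, f w <= g w) -> E f <= E g.
Proof. by move=> bf bg fg; apply: le_Rintegral. Qed.

Lemma mean_sum (F : nat -> T -> R) n : (forall k, bounded_rv (F k)) ->
  E (fun w => \sum_(k < n) F k w) = \sum_(k < n) E (F k).
Proof.
move=> bF; elim: n => [|n IH].
  by rewrite big_ord0; under eq_Rintegral do rewrite big_ord0; rewrite mean_cst.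
rewrite big_ord_recr -IH /=; under eq_Rintegral do rewrite big_ord_recr /=.
by rewrite meanD //; exact: bounded_rv_sum.
Qed.

Lemma EFin_mean f : bounded_rv f -> (E f)%:E = (\int[P]_w (f w)%:E)%E.
Proof.
by move=> bf; rewrite /Rintegral fineK //; apply: integrable_fin_num => //;
  exact: bounded_rv_integrable.
Qed.

(** Bienayme's identity, for orthogonal variables. *)
Lemma mean_sq_sum (W : nat -> T -> R) v n : (forall k, bounded_rv (W k)) ->
  (forall k, E (fun w => W k w * W k w) = v) ->
  (forall i j, (i < j)%N -> E (fun w => W i w * W j w) = 0) ->
  E (fun w => (\sum_(k < n) W k w) * (\sum_(k < n) W k w)) = n%:R * v.
Proof.
move=> bW W2 WW; elim: n => [|n IH].
  by rewrite mul0r; under eq_Rintegral do rewrite big_ord0 mul0r; rewrite mean_cst.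
pose S w := \sum_(k < n) W k w.
have bS : bounded_rv S by exact: bounded_rv_sum.
transitivity (E (fun w => (S w * S w + 2 * (S w * W n w)) + W n w * W n w)).
  by apply: eq_Rintegral => w _; rewrite big_ord_recr /= -/(S w); ring.
have b1 : bounded_rv (fun w => S w * S w) by exact: bounded_rvM.
have b2 : bounded_rv (fun w => S w * W n w) by exact: bounded_rvM.
have b3 : bounded_rv (fun w => 2 * (S w * W n w)).
  by apply: bounded_rvM => //; exact: bounded_rv_cst.
have b4 : bounded_rv (fun w => W n w * W n w) by exact: bounded_rvM.
rewrite meanD //; last exact: bounded_rvD.
rewrite meanD // meanZ // IH W2.
have -> : E (fun w => S w * W n w) = 0.
  under eq_Rintegral do rewrite /S mulr_suml.
  rewrite (@mean_sum (fun k w => W k w * W n w)); last first.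
    by move=> k; exact: bounded_rvM.
  by rewrite big1 // => k _; exact: WW.
by rewrite mulr0 addr0 -natr1; ring.
Qed.

End bounded_variables.

Section strong_law.
Context d (T : measurableType d) (R : realType) (P : probability T R).
Variable (Y : nat -> T -> R).
Hypothesis mY : forall k, measurable_fun setT (Y k).
Hypothesis Y_ge0 : forall k w, (0 <= Y k w)%R.
Hypothesis Y_id : forall k (A : set R), measurable A ->
  P (Y k @^-1` A) = P (Y 0%N @^-1` A).
Hypothesis Y_indep : forall i j (A B : set R), (i < j)%N -> measurable A -> measurable B ->
  P (Y i @^-1` A `&` Y j @^-1` B) = P (Y i @^-1` A) * P (Y j @^-1` B).

Let Ym k : {mfun T >-> R} := mfun_Sub (mem_set (mY k)).

Lemma same_expectation (g : R -> R) k : measurable_fun setT g -> (forall x, 0 <= g x)%R ->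
  \int[P]_w (g (Y k w))%:E = \int[P]_w (g (Y 0%N w))%:E.
Proof.
move=> mg g0.
have mg' : measurable_fun setT (EFin \o g) by exact/measurable_EFinP.
have h i : \int[distribution P (Ym i)]_x (g x)%:E = \int[P]_w (g (Y i w))%:E.
  by rewrite ge0_integral_distribution // => x; rewrite lee_fin.
rewrite -!h; apply: eq_measure_integral => A mA _; exact: Y_id.
Qed.

(** Pairwise independence makes the joint law the product of the marginals. *)
Lemma product_expectation (g : R -> R) i j : (i < j)%N -> measurable_fun setT g ->
  (forall x, 0 <= g x)%R ->
  \int[P]_w (g (Y i w) * g (Y j w))%:E =
  (\int[P]_w (g (Y 0%N w))%:E) * (\int[P]_w (g (Y 0%N w))%:E).
Proof.
move=> ij mg g0.
have mg' : measurable_fun setT (EFin \o g) by exact/measurable_EFinP.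
have mZ : measurable_fun setT (fun w => (Y i w, Y j w)) by exact: measurable_fun_pair.
pose Z : {mfun T >-> (R * R)%type} := mfun_Sub (mem_set mZ).
have mG : measurable_fun setT (fun x : R * R => (g x.1 * g x.2)%:E).
  apply/measurable_EFinP; apply: measurable_funM.
    by apply: measurableT_comp => //; exact: measurable_fst.
  by apply: measurableT_comp => //; exact: measurable_snd.
transitivity (\int[distribution P Z]_x (g x.1 * g x.2)%:E).
  rewrite ge0_integral_distribution // => x; rewrite lee_fin; exact: mulr_ge0.
transitivity (\int[distribution P (Ym i) \x distribution P (Ym j)]_x (g x.1 * g x.2)%:E).
  apply: eq_measure_integral => A mA _; apply/esym.
  apply: product_measure_unique => // B C mB mC; exact: Y_indep.
rewrite fubini_tonelli1 //; last by move=> x; rewrite lee_fin; exact: mulr_ge0.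
rewrite /fubini_F /=.
have h k : \int[distribution P (Ym k)]_x (g x)%:E = \int[P]_w (g (Y 0%N w))%:E.
  rewrite ge0_integral_distribution; last 2 first.
  - exact: mg'.
  - by move=> x; rewrite lee_fin.
  exact: same_expectation.
under eq_integral => x _.
  under eq_integral do rewrite EFinM.
  rewrite ge0_integralZl //; last 2 first.
  - by move=> y _; rewrite lee_fin.
  - by rewrite lee_fin.
  rewrite h muleC.
  over.
rewrite ge0_integralZl //; last 2 first.
- by move=> y _; rewrite lee_fin.
- by apply: integral_ge0 => w _; rewrite lee_fin.
by rewrite h.
Qed.

Local Open Scope ring_scope.
Local Notation E f := (\int[P]_w f w).

Definition cut t k w := Num.min (Y k w) t.
Definition cut_mean t := E (cut t 0).
Definition cut_sq t := E (fun w => cut t 0 w * cut t 0 w).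

Lemma cut_ge0 t k w : 0 <= t -> 0 <= cut t k w.
Proof. by move=> t0; rewrite le_min t0 andbT Y_ge0. Qed.

Lemma cut_le t k w : cut t k w <= t.
Proof. by rewrite /cut ge_min lexx orbT. Qed.

Lemma cut_bounded t k : 0 <= t -> bounded_rv (cut t k).
Proof.
move=> t0; split; first exact: measurable_minr.
by exists t => w; rewrite ger0_norm ?cut_le // cut_ge0.
Qed.

Let trunc t (x : R) : R := Num.max 0 (Num.min x t).

Let trunc_measurable t : measurable_fun setT (trunc t).
Proof. by apply: measurable_maxr => //; apply: measurable_minr. Qed.

Let trunc_ge0 t x : 0 <= trunc t x.
Proof. by rewrite /trunc le_max lexx. Qed.

Let trunc_cut t k w : 0 <= t -> trunc t (Y k w) = cut t k w.
Proof. by move=> t0; rewrite /trunc max_r // cut_ge0. Qed.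

Lemma mean_cut t k : 0 <= t -> E (cut t k) = cut_mean t.
Proof.
move=> t0; apply: EFin_inj; rewrite /cut_mean !EFin_mean; try exact: cut_bounded.
have := same_expectation k (trunc_measurable t) (trunc_ge0 t).
by under eq_integral do rewrite trunc_cut //; under [in RHS]eq_integral do rewrite trunc_cut //.
Qed.

Lemma mean_cut_sq t k : 0 <= t -> E (fun w => cut t k w * cut t k w) = cut_sq t.
Proof.
move=> t0; have bb i : bounded_rv (fun w => cut t i w * cut t i w).
  by apply: bounded_rvM; exact: cut_bounded.
apply: EFin_inj; rewrite /cut_sq !EFin_mean //.
have := @same_expectation (fun x => trunc t x * trunc t x) k
  (measurable_funM (trunc_measurable t) (trunc_measurable t))
  (fun x => mulr_ge0 (trunc_ge0 t x) (trunc_ge0 t x)).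
by under eq_integral do rewrite trunc_cut //; under [in RHS]eq_integral do rewrite trunc_cut //.
Qed.

Lemma mean_cut_prod t i j : 0 <= t -> (i < j)%N ->
  E (fun w => cut t i w * cut t j w) = cut_mean t * cut_mean t.
Proof.
move=> t0 ij; have bc k : bounded_rv (cut t k) by exact: cut_bounded.
apply: EFin_inj; rewrite EFinM /cut_mean !EFin_mean //; last exact: bounded_rvM.
have := product_expectation ij (trunc_measurable t) (trunc_ge0 t).
under eq_integral do rewrite !trunc_cut //.
by under [X in _ = (X * _)%E -> _]eq_integral do rewrite trunc_cut //;
  under [X in _ = (_ * X)%E -> _]eq_integral do rewrite trunc_cut //.
Qed.

(** With [n] the integer part of [t], the first term is the squared error of the
average of [n] truncated variables, and the second one is at least 1 as soon as the
truncation at [t] alters one of these variables. A single summable quantity thus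
bounds both the error of the truncated average and that of the truncation. *)
Definition fluctuation t w :=
  let n := Num.truncn t in
  let S := \sum_(k < n) (cut t k w - cut_mean t) in
  n%:R ^- 2 * (S * S) + t ^- 2 * \sum_(k < n) (cut t k w * cut t k w).

Lemma fluctuation_bounded t : 0 <= t -> bounded_rv (fluctuation t).
Proof.
move=> t0; have bc k : bounded_rv (cut t k) by exact: cut_bounded.
have bw k : bounded_rv (fun w => cut t k w - cut_mean t).
  by apply: bounded_rvD => //; exact: bounded_rv_cst.
have bs := bounded_rv_sum (F := fun k w => cut t k w - cut_mean t) (Num.truncn t) bw.
apply: bounded_rvD; (apply: bounded_rvM; first exact: bounded_rv_cst).
  exact: bounded_rvM.
by apply: (@bounded_rv_sum _ _ _ (fun k w => cut t k w * cut t k w)) => k; exact: bounded_rvM.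
Qed.

Lemma fluctuation_ge0 t w : 0 <= fluctuation t w.
Proof.
apply: addr_ge0; apply: mulr_ge0.
- by rewrite invr_ge0 sqr_ge0.
- by rewrite -expr2 sqr_ge0.
- by rewrite invr_ge0 sqr_ge0.
- by apply: sumr_ge0 => k _; rewrite -expr2 sqr_ge0.
Qed.

Lemma mean_fluctuation t : 1 <= t -> E (fluctuation t) <= 3 * (cut_sq t / t).
Proof.
move=> t1; have t0 : 0 <= t by exact: le_trans t1.
have tp : 0 < t by exact: lt_le_trans t1.
have bc k : bounded_rv (cut t k) by exact: cut_bounded.
set n := Num.truncn t; set c := cut_mean t.
have bw k : bounded_rv (fun w => cut t k w - c).
  by apply: bounded_rvD => //; exact: bounded_rv_cst.
have bcc i j : bounded_rv (fun w => cut t i w * cut t j w) by exact: bounded_rvM.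
have bs := bounded_rv_sum (F := fun k w => cut t k w - c) n bw.
have bss := bounded_rvM bs bs.
have bq := bounded_rv_sum (F := fun k w => cut t k w * cut t k w) n (fun k => bcc k k).
have wij i j : E (fun w => (cut t i w - c) * (cut t j w - c)) =
    E (fun w => cut t i w * cut t j w) - c * c.
  transitivity (E (fun w => (cut t i w * cut t j w + (- c) * cut t i w) +
      ((- c) * cut t j w + c * c))).
    by apply: eq_Rintegral => w _; ring.
  have bz k : bounded_rv (fun w => - c * cut t k w).
    by apply: bounded_rvM => //; exact: bounded_rv_cst.
  have bcs : bounded_rv (fun w : T => c * c) by exact: bounded_rv_cst.
  rewrite meanD //; [|exact: bounded_rvD|exact: bounded_rvD].
  rewrite !meanD // (mean_cst P (c * c)) !meanZ // !mean_cut // -/c; ring.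
have ES : E (fun w => (\sum_(k < n) (cut t k w - c)) * (\sum_(k < n) (cut t k w - c))) =
    n%:R * (cut_sq t - c * c).
  apply: (mean_sq_sum (W := fun k w => cut t k w - c)) => //.
    by move=> k; rewrite wij mean_cut_sq.
  by move=> i j ij; rewrite wij mean_cut_prod // subrr.
have -> : E (fluctuation t) = n%:R ^- 2 * (n%:R * (cut_sq t - c * c)) +
    t ^- 2 * (n%:R * cut_sq t).
  rewrite /fluctuation -/n -/c meanD; last 2 first.
  - by apply: bounded_rvM => //; exact: bounded_rv_cst.
  - by apply: bounded_rvM => //; exact: bounded_rv_cst.
  rewrite !meanZ // ES (@mean_sum _ _ _ _ (fun k w => cut t k w * cut t k w)) //.
  congr (_ + _ * _); under eq_bigr do rewrite mean_cut_sq //.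
  by rewrite sumr_const card_ord mulr_natl.
have /andP[n1 n2] := truncn_half t1; rewrite -/n in n1 n2.
have np : 0 < n%:R :> R by apply: lt_le_trans n1; rewrite divr_gt0.
have s0 : 0 <= cut_sq t.
  by apply: Rintegral_ge0 => w _; rewrite -expr2 sqr_ge0.
have c0 : 0 <= c * c by rewrite -expr2 sqr_ge0.
have -> : n%:R ^- 2 * (n%:R * (cut_sq t - c * c)) = (cut_sq t - c * c) / n%:R.
  by field; rewrite lt0r_neq0.
have -> : t ^- 2 * (n%:R * cut_sq t) = n%:R / t * (cut_sq t / t).
  by field; rewrite lt0r_neq0.
have st0 : 0 <= cut_sq t / t by rewrite divr_ge0.
have h1 : (cut_sq t - c * c) / n%:R <= 2 * (cut_sq t / t).
  rewrite ler_pdivrMr //; apply: (@le_trans _ _ (cut_sq t)); first by rewrite gerBl.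
  have -> : 2 * (cut_sq t / t) * n%:R = cut_sq t * (n%:R / (t / 2)).
    by field; rewrite lt0r_neq0.
  by rewrite ler_peMr // ler_pdivlMr ?divr_gt0 // mul1r.
have h2 : n%:R / t * (cut_sq t / t) <= cut_sq t / t.
  by rewrite ler_piMl // ler_pdivrMr // mul1r.
lra.
Qed.

Variable m : R.
Hypothesis Y_mean : (\int[P]_w (Y 0%N w)%:E = m%:E)%E.

Let Y0_integrable : P.-integrable setT (EFin \o Y 0%N).
Proof.
apply/integrableP; split; first exact/measurable_EFinP.
by under eq_integral do rewrite /= ger0_norm //; rewrite Y_mean ltry.
Qed.

Lemma common_mean_ge0 : 0 <= m.
Proof. by rewrite -lee_fin -Y_mean; apply: integral_ge0 => w _; rewrite lee_fin. Qed.

Lemma sum_cut_sq_le alpha J : 1 < alpha ->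
  \sum_(j < J) cut_sq (alpha ^+ j) / alpha ^+ j <= 4 * alpha / (alpha - 1) * m.
Proof.
move=> al1; have al0 : 0 < alpha by exact: lt_trans al1.
have a0 j : 0 <= alpha ^+ j by rewrite exprn_ge0 // ltW.
have bcc j : bounded_rv (fun w => cut (alpha ^+ j) 0 w * cut (alpha ^+ j) 0 w).
  by apply: bounded_rvM; exact: cut_bounded.
have bz j : bounded_rv (fun w => (alpha ^+ j)^-1 *
    (cut (alpha ^+ j) 0 w * cut (alpha ^+ j) 0 w)).
  by apply: bounded_rvM => //; exact: bounded_rv_cst.
have -> : \sum_(j < J) cut_sq (alpha ^+ j) / alpha ^+ j =
    E (fun w => \sum_(j < J) ((alpha ^+ j)^-1 *
       (cut (alpha ^+ j) 0 w * cut (alpha ^+ j) 0 w))).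
  rewrite (@mean_sum _ _ _ _ (fun j w => (alpha ^+ j)^-1 *
    (cut (alpha ^+ j) 0 w * cut (alpha ^+ j) 0 w))) //.
  by apply: eq_bigr => j _; rewrite meanZ // mulrC.
have -> : m = E (Y 0%N) by rewrite /Rintegral Y_mean.
rewrite -RintegralZl //; apply: mean_le.
- by apply: bounded_rv_integrable; exact: (bounded_rv_sum (F := fun j w =>
    (alpha ^+ j)^-1 * (cut (alpha ^+ j) 0 w * cut (alpha ^+ j) 0 w))).
- under [_ \o _]eq_fun do rewrite /= EFinM.
  exact: (integrableZl measurableT).
move=> w; apply: le_trans (sum_min_sq_le J al1 (Y_ge0 0 w)).
by apply: ler_sum => j _; rewrite mulrC -expr2.
Qed.

(** The expectation of the series is finite, by [mean_fluctuation] and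
[sum_cut_sq_le], so the series is finite almost surely. *)
Lemma fluctuation_summable alpha : 1 < alpha ->
  {ae P, forall w, (\sum_(0 <= j <oo) (fluctuation (alpha ^+ j) w)%:E < +oo)%E}.
Proof.
move=> al1; have al0 : 0 < alpha by exact: lt_trans al1.
have a1 j : 1 <= alpha ^+ j by rewrite exprn_ege1 // ltW.
have a0 j : 0 <= alpha ^+ j by exact: le_trans (a1 j).
have mfl j : measurable_fun setT (fun w => (fluctuation (alpha ^+ j) w)%:E).
  by apply/measurable_EFinP; case: (fluctuation_bounded (a0 j)).
have fl0 j w : (0 <= (fluctuation (alpha ^+ j) w)%:E)%E.
  by rewrite lee_fin fluctuation_ge0.
pose F w := (\sum_(0 <= j <oo) (fluctuation (alpha ^+ j) w)%:E)%E.
have F0 w : (0 <= F w)%E by apply: nneseries_ge0 => j _ _; exact: fl0.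
have mF : measurable_fun setT F.
  by apply: ge0_emeasurable_sum => // k w _ _; exact: fl0.
have hF : (\int[P]_w F w <= (3 * (4 * alpha / (alpha - 1) * m))%:E)%E.
  rewrite integral_nneseries //.
  apply: lime_le.
    by apply: is_cvg_nneseries => j _ _; apply: integral_ge0.
  apply: nearW => J; rewrite big_mkord.
  rewrite (eq_bigr (fun j : 'I_J => (E (fluctuation (alpha ^+ j)))%:E)); last first.
    by move=> j _; rewrite EFin_mean //; exact: fluctuation_bounded.
  rewrite sumEFin lee_fin.
  apply: (@le_trans _ _ (\sum_(j < J) 3 * (cut_sq (alpha ^+ j) / alpha ^+ j))).
    by apply: ler_sum => j _; exact: mean_fluctuation.
  by rewrite -mulr_sumr ler_wpM2l // sum_cut_sq_le.
have iF : P.-integrable setT F.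
  apply/integrableP; split => //.
  under eq_integral do rewrite gee0_abs //.
  exact: le_lt_trans hF (ltry _).
have := integrable_ae measurableT iF; apply: filterS => w /(_ I).
by rewrite ge0_fin_numE.
Qed.

Lemma cut_mean_cvg alpha : 1 < alpha -> cut_mean (alpha ^+ j) @[j --> \oo] --> m.
Proof.
move=> al1; have al0 : 0 < alpha by exact: lt_trans al1.
have a0 j : 0 <= alpha ^+ j by rewrite exprn_ge0 // ltW.
suff h : (cut_mean (alpha ^+ j))%:E @[j --> \oo] --> m%:E by exact: (fine_cvg h).
have cvw w : (cut (alpha ^+ j) 0 w)%:E @[j --> \oo] --> (Y 0%N w)%:E.
  have [n hn] : exists n, Y 0%N w <= alpha ^+ n.
    have [->|Yn0] := eqVneq (Y 0%N w) 0; first by exists 0%N.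
    pose N := (Num.truncn (Y 0%N w)).+1.
    have [j /andP[_ hj]] := geometric_floor (n := N) al1 isT.
    exists j.+1; apply: ltW; apply: lt_trans hj; exact: truncnS_gt.
  apply: cvg_near_cst; exists n => // j /= nj.
  rewrite /cut min_l //; apply: le_trans hn _.
  by rewrite ler_weXn2l // ltW.
have -> : (fun j => (cut_mean (alpha ^+ j))%:E) =
    (fun j => \int[P]_w (cut (alpha ^+ j) 0 w)%:E)%E.
  by apply/funext => j; rewrite EFin_mean //; exact: cut_bounded.
have := @cvg_monotone_convergence _ _ _ P _ measurableT
  (fun j w => (cut (alpha ^+ j) 0 w)%:E).
under eq_integral => w _ do rewrite (cvg_lim _ (cvw w)) //.
rewrite Y_mean; apply.
- by move=> j; apply/measurable_EFinP; case: (cut_bounded 0 (a0 j)).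
- by move=> j w _; rewrite lee_fin cut_ge0.
- move=> w _ i j ij; rewrite lee_fin /cut le_min ge_min lexx /= ge_min.
  by rewrite ler_weXn2l ?orbT // ltW.
Qed.

(** Etemadi's argument. Along each geometric subsequence the fluctuations tend to 0,
so that eventually the truncation changes nothing and the average is close to
the truncated mean; monotonicity of the partial sums fills the gaps. *)
Theorem strong_law_of_large_numbers :
  {ae P, forall w, forall eps : R, 0 < eps -> exists C : R, forall n : nat,
    `|\sum_(k < n) Y k w - n%:R * m| <= C + eps * n%:R}.
Proof.
have : {ae P, forall w, forall i : nat,
    (\sum_(0 <= j <oo) (fluctuation ((1 + i.+1%:R^-1) ^+ j) w)%:E < +oo)%E}.
  by apply: ae_foralln => i; apply: fluctuation_summable; rewrite ltrDl.
apply: filterS => w hw; apply: (interpolate_averages (y := fun k => Y k w) (m := m)).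
- by move=> k; exact: Y_ge0.
- exact: common_mean_ge0.
move=> i alpha delta delta0.
have al1 : 1 < alpha by rewrite ltrDl.
have a1 j : 1 <= alpha ^+ j by rewrite exprn_ege1 // ltW.
have ap j : 0 < alpha ^+ j by exact: lt_le_trans (a1 j).
have fl0 j : (0 <= (fluctuation (alpha ^+ j) w)%:E)%E by rewrite lee_fin fluctuation_ge0.
pose eta := Num.min (1 / 2) ((delta / 2) ^+ 2).
have eta0 : 0 < eta by rewrite lt_min divr_gt0 //= exprn_gt0 // divr_gt0.
have [J1 _ hJ1] : \forall j \near \oo, fluctuation (alpha ^+ j) w <= eta.
  have := nneseries_tail_cvg (hw i) (fun j _ => fl0 j).
  move=> /fine_cvgP[fin /cvgrPdist_le/(_ _ eta0)]; apply: filterS2 fin => j fj /=.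
  rewrite sub0r normrN => hj.
  rewrite -lee_fin; apply: (@le_trans _ _ (\sum_(j <= k <oo) (fluctuation (alpha ^+ k) w)%:E)%E).
    apply: le_trans (nneseries_lim_ge j.+1 _); last by move=> *; exact: fl0.
    by rewrite big_nat1.
  rewrite -(fineK fj) lee_fin; apply: le_trans hj; exact: ler_norm.
have d20 : 0 < delta / 2 by rewrite divr_gt0.
have [J2 _ hJ2] : \forall j \near \oo, `|m - cut_mean (alpha ^+ j)| <= delta / 2.
  by have /cvgrPdist_le/(_ _ d20) := cut_mean_cvg al1.
exists (maxn J1 J2) => j; rewrite geq_max => /andP[/hJ1 /= f1 /hJ2 /= f2].
set t := alpha ^+ j in f1 f2 *; set n := Num.truncn t in f1 *.
have /andP[n1 n2] := truncn_half (a1 j); rewrite -/t -/n in n1 n2.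
have tp : 0 < t by exact: ap.
have np : 0 < n%:R :> R by apply: lt_le_trans n1; rewrite divr_gt0.
set S := \sum_(k < n) (cut t k w - cut_mean t).
have q1 : 0 <= n%:R ^- 2 * (S * S).
  by rewrite mulr_ge0 ?invr_ge0 ?sqr_ge0 // -expr2 sqr_ge0.
have q2 : 0 <= t ^- 2 * \sum_(k < n) (cut t k w * cut t k w).
  rewrite mulr_ge0 ?invr_ge0 ?sqr_ge0 //.
  by apply: sumr_ge0 => k _; rewrite -expr2 sqr_ge0.
have fE : fluctuation t w = n%:R ^- 2 * (S * S) +
  t ^- 2 * \sum_(k < n) (cut t k w * cut t k w) by [].
have [e1 e2] : eta <= 1 / 2 /\ eta <= (delta / 2) ^+ 2.
  by rewrite /eta !ge_min !lexx orbT.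
have cutE (k : 'I_n) : cut t k w = Y k w.
  rewrite /cut min_l // leNgt; apply/negP => tY.
  have : t ^- 2 * (t * t) <= t ^- 2 * \sum_(k < n) (cut t k w * cut t k w).
    rewrite ler_wpM2l ?invr_ge0 ?sqr_ge0 // (bigD1 k) //=.
    have cE : cut t k w = t by rewrite /cut min_r // ltW.
    rewrite cE lerDl; apply: sumr_ge0 => i' _.
    by rewrite -expr2 sqr_ge0.
  rewrite -expr2 mulVf ?sqrf_eq0 ?lt0r_neq0 //; move: f1; rewrite fE; lra.
have SE : S = \sum_(k < n) Y k w - n%:R * cut_mean t.
  rewrite /S sumrB sumr_const card_ord mulr_natl; congr (_ - _).
  by apply: eq_bigr => k _; exact: cutE.
have hS : `|S| <= delta / 2 * n%:R.
  have h : S ^+ 2 <= (delta / 2 * n%:R) ^+ 2.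
    have : n%:R ^- 2 * (S * S) <= (delta / 2) ^+ 2 by move: f1; rewrite fE; lra.
    have -> : S ^+ 2 = n%:R ^- 2 * (S * S) * n%:R ^+ 2 by field; rewrite lt0r_neq0.
    by move=> h; rewrite exprMn; apply: ler_wpM2r h; exact: sqr_ge0.
  have r0 : 0 <= delta / 2 * n%:R by apply: mulr_ge0; exact: ltW.
  by rewrite -(ler_pXn2r (ltn0Sn 1)) ?nnegrE // real_normK ?num_real.
have -> : \sum_(k < n) Y k w - n%:R * m = S + n%:R * (cut_mean t - m).
  by rewrite SE; ring.
apply: le_trans (ler_normD _ _) _.
rewrite normrM (ger0_norm (ltW np)) distrC.
have := ler_wpM2l (ltW np) f2; lra.
Qed.

End strong_law.

(** * Measurable functionals of the offspring law *)
Section integral_aux.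
Context d (T : measurableType d) (R : realType) (P : probability T R).

(** The integral of a nonnegative function is a supremum over the simple functions
below it, so monotonicity extends to functions that may fail to be measurable. *)
Lemma ge0_integral_mono (f g : T -> \bar R) : (forall x, 0 <= f x) ->
  (forall x, f x <= g x) -> \int[P]_x f x <= \int[P]_x g x.
Proof.
move=> f0 fg; rewrite !ge0_integralTE //; last by move=> x; exact: le_trans (fg x).
apply: ereal_sup_le => _ [h hf <-]; exists h => // x.
exact: le_trans (fg x).
Qed.

Lemma measurable_lne : measurable_fun setT (@lne R).
Proof.
apply: (measurability _ (ErealGenOInfty.measurableE R)) => _ [_ [c ->] <-].
rewrite setTI (_ : _ @^-1` _ = `](expR c)%:E, +oo[%classic); first exact: emeasurable_itv.
apply/seteqP; split => [[r| |]|[r| |]] //=; rewrite !in_itv /= !andbT //.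
- case: ifPn => //; rewrite -ltNge => r0; rewrite !lte_fin => h.
  by rewrite -(lnK (x := r)) ?posrE // ltr_expR.
- by rewrite !ltry.
- rewrite lte_fin => h; have r0 : (0 < r)%R by apply: lt_trans h; exact: expR_gt0.
  by rewrite leNgt r0 /= lte_fin -ltr_expR lnK.
- by rewrite !ltry.
Qed.

End integral_aux.

Section offspring_functionals.
Context (R : realType).
Implicit Types F : probability nat R.

Let law_space := g_sigma_algebraType (@tv_open R).

Lemma fine_probability_unit F A : (0 <= fine (F A) <= 1)%R.
Proof.
rewrite fine_ge0 //= -lee_fin fineK ?fin_num_measure //.
exact: probability_le1.
Qed.

Lemma le_tv_dist (F G : probability nat R) (A : set nat) :
  (`|fine (F A) - fine (G A)| <= tv_dist F G)%R.
Proof.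
apply: ub_le_sup; last by exists A.
exists 1%R => _ [B _ <-].
have /andP[f0 f1] := fine_probability_unit F B.
have /andP[g0 g1] := fine_probability_unit G B.
by rewrite ler_norml; apply/andP; split; lra.
Qed.

(** Evaluation at a set is 1-Lipschitz for the total variation distance. *)
Lemma tv_open_gt (A : set nat) (c : R) : tv_open [set F | (c < fine (F A))%R].
Proof.
move=> F /= cF; exists (fine (F A) - c)%R; first by rewrite subr_gt0.
move=> G FG; have := le_lt_trans (le_tv_dist F G A) FG.
by rewrite ltr_norml => /andP[]; lra.
Qed.

Lemma measurable_eval (A : set nat) : measurable_fun setT (fun F : law_space => F A).
Proof.
have mf : measurable_fun setT (fun F : law_space => fine (F A)).
  apply: (measurability _ (RGenOInfty.measurableE R)) => _ [_ [c ->] <-].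
  rewrite setTI; apply: sub_gen_smallest.
  have := @tv_open_gt A c; congr (tv_open _).
  by apply/seteqP; split => F /=; rewrite in_itv /= andbT.
rewrite (_ : (fun F : law_space => F A) = (fun F : law_space => (fine (F A))%:E)).
  exact/measurable_EFinP.
by apply/funext => F; rewrite fineK // fin_num_measure.
Qed.

Lemma mean_offspring_ge0 F : 0 <= mean_offspring F.
Proof. by apply: nneseries_ge0 => k _ _; apply: mule_ge0 => //; rewrite lee_fin. Qed.

Lemma measurable_mean_offspring :
  measurable_fun setT (fun F : law_space => mean_offspring F).
Proof.
apply: ge0_emeasurable_sum => [k F _ _|k _]; first by apply: mule_ge0; rewrite ?lee_fin.
by apply: measurable_funeM; exact: measurable_eval.
Qed.

Definition fact_moment F : \bar R :=
  \sum_(1 <= k <oo) ((k * k.-1)%:R%:E * F [set k]).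

Lemma fact_moment_series F :
  fact_moment F = \sum_(0 <= k <oo) ((k * k.-1)%:R%:E * F [set k]).
Proof.
rewrite [RHS]nneseries_recl //; first by rewrite mul0n mul0e add0e.
by move=> k _; apply: mule_ge0 => //; rewrite lee_fin.
Qed.

Lemma fact_moment_ge0 F : 0 <= fact_moment F.
Proof. by apply: nneseries_ge0 => k _ _; apply: mule_ge0 => //; rewrite lee_fin. Qed.

Lemma measurable_fact_moment :
  measurable_fun setT (fun F : law_space => fact_moment F).
Proof.
under eq_fun do rewrite fact_moment_series.
apply: ge0_emeasurable_sum => [k F _ _|k _]; first by apply: mule_ge0; rewrite ?lee_fin.
by apply: measurable_funeM; exact: measurable_eval.
Qed.

Definition real_mean F : R := fine (mean_offspring F).
Definition real_log_mean F : R := ln (real_mean F).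

(** A real-valued weight in place of the inverse in [\bar R]: the value is that of
[norm_fact_moment] when the mean is positive and finite and lies below it
otherwise, so that it inherits the finite expectation. *)
Definition eta_below F : \bar R := ((real_mean F `^ (-1)) ^+ 2)%:E * fact_moment F.
Definition real_eta F : R := fine (eta_below F).

Lemma eta_below_ge0 F : 0 <= eta_below F.
Proof.
by apply: mule_ge0; [rewrite lee_fin sqr_ge0|exact: fact_moment_ge0].
Qed.

Lemma measurable_real_mean : measurable_fun setT (fun F : law_space => real_mean F).
Proof.
exact: (measurableT_comp (fine_measurable measurableT) measurable_mean_offspring).
Qed.

Lemma measurable_real_log_mean :
  measurable_fun setT (fun F : law_space => real_log_mean F).
Proof.
exact: (measurableT_comp (@measurable_ln R) measurable_real_mean).
Qed.

Lemma measurable_eta_below : measurable_fun setT (fun F : law_space => eta_below F).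
Proof.
apply: emeasurable_funM; last exact: measurable_fact_moment.
apply/measurable_EFinP; apply: measurable_funX.
exact: (measurableT_comp (measurable_powR (-1)) measurable_real_mean).
Qed.

Lemma measurable_real_eta : measurable_fun setT (fun F : law_space => real_eta F).
Proof. exact: (measurableT_comp (fine_measurable measurableT) measurable_eta_below). Qed.

Lemma real_eta_ge0 F : (0 <= real_eta F)%R.
Proof. by rewrite /real_eta fine_ge0 // eta_below_ge0. Qed.

Lemma eta_below_le F : eta_below F <= norm_fact_moment F.
Proof.
rewrite /eta_below /norm_fact_moment; have b0 := fact_moment_ge0 F.
apply: lee_wpmul2r => //; rewrite /real_mean.
have := mean_offspring_ge0 F; case: (mean_offspring F) => [r| |] //=.
- rewrite lee_fin inver => r0; case: ifPn => [/eqP ->|rn0].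
    by rewrite powR0 ?oppr_eq0 ?oner_eq0 // expr0n /= mulyy leey.
  by rewrite powR_inv1 // expr2 EFinM.
- by rewrite powR0 ?oppr_eq0 ?oner_eq0 // expr0n /= invey mul0e.
Qed.

(** Equivalently, the mean is positive and finite and the second factorial moment is
finite. *)
Definition regular F :=
  (lne (mean_offspring F) \is a fin_num) /\ (eta_below F \is a fin_num).

Lemma regular_mean F : regular F ->
  (0 < real_mean F)%R /\ mean_offspring F = (real_mean F)%:E.
Proof.
move=> [+ _]; rewrite /real_mean; case: (mean_offspring F) => [r| |] //=.
by case: ifPn => //; rewrite -ltNge.
Qed.

Lemma regular_log_mean F : regular F ->
  lne (mean_offspring F) = (real_log_mean F)%:E.
Proof.
by move=> /regular_mean[m0 mE]; rewrite mE lne_EFin.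
Qed.

Lemma regular_eta F : regular F ->
  exists b : R, fact_moment F = b%:E /\ real_eta F = (b / real_mean F ^+ 2)%R.
Proof.
move=> rF; have [m0 _] := regular_mean rF; case: rF => _.
have mi := ltW m0; have := fact_moment_ge0 F; rewrite /real_eta /eta_below powR_inv1 //.
have v0 : (0 < (real_mean F)^-1 ^+ 2)%R by rewrite exprn_gt0 // invr_gt0.
case: (fact_moment F) => [b| |] // _; last by rewrite gt0_muley // lte_fin.
by move=> _; exists b; split => //=; rewrite exprVn mulrC.
Qed.

Lemma measurable_regular : measurable ([set F | regular F] : set law_space).
Proof.
rewrite (_ : [set _ | _] =
  [set F : law_space | lne (mean_offspring F) \is a fin_num] `&`
  [set F : law_space | eta_below F \is a fin_num]) //.
apply: measurableI; rewrite -[X in measurable X]setTI; apply: emeasurable_fin_num => //.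
  exact: (measurableT_comp (@measurable_lne R) measurable_mean_offspring).
exact: measurable_eta_below.
Qed.

End offspring_functionals.

(** * Typical environments *)
Section typical_environments.
Context d (Omega : measurableType d) (R : realType) (PE : probability Omega R).
Context (xi : int -> Omega -> probability nat R) (a : R).
Hypothesis xi_iid : iid_environment PE xi.
Hypothesis aE : \int[PE]_w log_mean xi 1%R w = a%:E.
Hypothesis eta_fin : \int[PE]_w eta_ xi 1%R w < +oo.

Let law_space := g_sigma_algebraType (@tv_open R).

Let measurable_xi k : measurable_fun setT (xi k : Omega -> law_space).
Proof. by case: xi_iid => mxi _ _ _ B mB; rewrite setTI; exact: mxi. Qed.

Lemma environment_law (k : int) (B : set (probability nat R)) : tv_borel B ->
  PE (xi k @^-1` B) = PE (xi 1%R @^-1` B).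
Proof. by case: xi_iid => _ h _ mB; rewrite (h k) // -(h 1%R). Qed.

Lemma environment_slln (h : probability nat R -> R) (m : R) :
  measurable_fun setT (h : law_space -> R) -> (forall F, 0 <= h F)%R ->
  \int[PE]_w (h (xi 1%R w))%:E = m%:E ->
  {ae PE, forall w, forall eps : R, (0 < eps)%R -> exists C : R, forall n : nat,
    (`|\sum_(k < n) h (xi (Posz k.+1) w) - n%:R * m| <= C + eps * n%:R)%R}.
Proof.
move=> mh h0 hm; have hB (A : set R) : measurable A -> tv_borel (h @^-1` A).
  by move=> mA; rewrite -[X in tv_borel X]setTI; exact: mh.
apply: (@strong_law_of_large_numbers _ _ _ PE (fun k w => h (xi (Posz k.+1) w))) => //.
- by move=> k; apply: (measurableT_comp mh); exact: measurable_xi.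
- by move=> k A mA; exact: environment_law (hB _ mA).
move=> i j A B ij mA mB; case: xi_iid => _ _ ind.
pose E (k : int) := if k == Posz i.+1 then xi k @^-1` (h @^-1` A) else xi k @^-1` (h @^-1` B).
have ijn : (Posz j.+1 == Posz i.+1) = false.
  by apply/negP => /eqP[ji]; rewrite ji ltnn in ij.
have := ind [:: Posz i.+1; Posz j.+1] E.
rewrite bigcap_seq !big_cons !big_nil setIT mule1 /E eqxx ijn; apply.
  by rewrite /= inE eq_sym ijn.
move=> k; rewrite !inE => /orP[/eqP ->|/eqP ->]; rewrite ?eqxx ?ijn.
  by exists (h @^-1` A); [exact: hB|rewrite setTI].
by exists (h @^-1` B); [exact: hB|rewrite setTI].
Qed.

Let measurable_log : measurable_fun setT (log_mean xi 1%R).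
Proof.
exact: (measurableT_comp (@measurable_lne R)
  (measurableT_comp (@measurable_mean_offspring R) (measurable_xi 1%R))).
Qed.

Let log_integrable : PE.-integrable setT (log_mean xi 1%R).
Proof.
apply/integrableP; split => //; apply/(abse_integralP PE measurableT measurable_log).
by rewrite aE ltry.
Qed.

Let measurable_eta1 : measurable_fun setT (fun w => eta_below (xi 1%R w)).
Proof. exact: (measurableT_comp (@measurable_eta_below R) (measurable_xi 1%R)). Qed.

Let eta_integrable : PE.-integrable setT (fun w => eta_below (xi 1%R w)).
Proof.
apply/integrableP; split => //.
under eq_integral do rewrite gee0_abs ?eta_below_ge0 //.
apply: le_lt_trans eta_fin; apply: ge0_integral_mono => w; first exact: eta_below_ge0.
exact: eta_below_le.
Qed.

Lemma regular_first : {ae PE, forall w, regular (xi 1%R w)}.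
Proof.
have := integrable_ae measurableT eta_integrable.
have := integrable_ae measurableT log_integrable.
by apply: filterS2 => w h1 h2; split; [exact: h1|exact: h2].
Qed.

Lemma regular_all : {ae PE, forall w, forall k : nat, regular (xi (Posz k.+1) w)}.
Proof.
apply: ae_foralln => k.
have mN : tv_borel (~` [set F : probability nat R | regular F]).
  apply: (@measurableC _ law_space); exact: measurable_regular.
exists (xi (Posz k.+1) @^-1` ~` [set F : probability nat R | regular F]); split => //.
  by case: xi_iid => mxi _ _; exact: mxi.
transitivity (PE (xi 1%R @^-1` ~` [set F : probability nat R | regular F])).
  exact: environment_law.
apply/negligibleP; last exact: regular_first.
by case: xi_iid => mxi _ _; exact: mxi.
Qed.

Local Open Scope ring_scope.

(** The strong law holds for nonnegative variables, so it is applied to the positive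
and negative parts of the log-mean separately. *)
Lemma environment_typical : {ae PE, forall w,
  [/\ forall k : nat, regular (xi (Posz k.+1) w),
      forall eps : R, 0 < eps -> exists C : R, forall n : nat,
        `|\sum_(k < n) real_log_mean (xi (Posz k.+1) w) - n%:R * a| <= C + eps * n%:R &
      exists C : R, forall n : nat,
        \sum_(k < n) real_eta (xi (Posz k.+1) w) <= C * (n%:R + 1)]}.
Proof.
have mlog := @measurable_real_log_mean R.
pose hp (F : probability nat R) := Num.max (real_log_mean F) 0.
pose hn (F : probability nat R) := Num.max (- real_log_mean F) 0.
have mp : measurable_fun setT (hp : law_space -> R) by exact: measurable_maxr.
have mn : measurable_fun setT (hn : law_space -> R).
  by apply: measurable_maxr => //; exact: measurableT_comp.
have logE : ae_eq PE setT (log_mean xi 1%R) (fun w => (real_log_mean (xi 1%R w))%:E).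
  by apply: filterS regular_first => w rw _; exact: regular_log_mean.
have mlog1 : measurable_fun setT (fun w => (real_log_mean (xi 1%R w))%:E).
  apply/measurable_EFinP; exact: (measurableT_comp mlog (measurable_xi 1%R)).
have ilog : PE.-integrable setT (EFin \o (fun w => real_log_mean (xi 1%R w))).
  apply/integrableP; split => //.
  have /integrableP[_] := log_integrable.
  rewrite (ge0_ae_eq_integral (g := fun w => `|(real_log_mean (xi 1%R w))%:E|%E)) //.
  - exact: (measurableT_comp (@abse_measurable R setT) measurable_log).
  - exact: (measurableT_comp (@abse_measurable R setT) mlog1).
  - by apply: filterS logE => w lw /lw ->.
have rint (f : probability nat R -> R) :
    PE.-integrable setT (fun w => (f (xi 1%R w))%:E) ->
    (\int[PE]_w (f (xi 1%R w))%:E)%E = (\int[PE]_w f (xi 1%R w))%:E.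
  by move=> h; rewrite /Rintegral fineK //; exact: integrable_fin_num.
have ip : PE.-integrable setT (fun w => (hp (xi 1%R w))%:E).
  apply: le_integrable ilog => //.
    apply/measurable_EFinP; exact: (measurableT_comp mp (measurable_xi 1%R)).
  move=> w _ /=; rewrite lee_fin /hp; case: (leP (real_log_mean (xi 1 w)) 0) => h.
    by rewrite normr0.
  by [].
have in_ : PE.-integrable setT (fun w => (hn (xi 1%R w))%:E).
  apply: le_integrable ilog => //.
    apply/measurable_EFinP; exact: (measurableT_comp mn (measurable_xi 1%R)).
  move=> w _ /=; rewrite lee_fin /hn; case: (leP (- real_log_mean (xi 1 w)) 0) => h.
    by rewrite normr0.
  by rewrite normrN.
have ie : PE.-integrable setT (fun w => (real_eta (xi 1%R w))%:E).
  apply: le_integrable eta_integrable => //.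
    apply/measurable_EFinP.
    exact: (measurableT_comp (@measurable_real_eta R) (measurable_xi 1%R)).
  move=> w _ /=; rewrite ger0_norm ?real_eta_ge0 // gee0_abs ?eta_below_ge0 //.
  rewrite /real_eta; have := eta_below_ge0 (xi 1 w).
  by case: (eta_below _) => [r| |] //= _; rewrite ?leey.
pose ap := \int[PE]_w hp (xi 1%R w); pose an := \int[PE]_w hn (xi 1%R w).
have hpn F : real_log_mean F = hp F - hn F.
  rewrite /hp /hn; case: (leP (real_log_mean F) 0) => h1;
    case: (leP (- real_log_mean F) 0) => h2; lra.
have apn : a = ap - an.
  apply: EFin_inj; rewrite -aE EFinB -!rint // -integralB //.
  apply: ae_eq_integral => //.
  - apply: emeasurable_funB; first exact: measurable_int ip.
    exact: measurable_int in_.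
  - by apply: filterS logE => w lw /lw ->; rewrite hpn EFinB.
have hp0 F : 0 <= hp F by rewrite le_max lexx orbT.
have hn0 F : 0 <= hn F by rewrite le_max lexx orbT.
have sp := environment_slln mp hp0 (rint _ ip).
have sn := environment_slln mn hn0 (rint _ in_).
have se := environment_slln (@measurable_real_eta R) (@real_eta_ge0 R) (rint _ ie).
apply: filter_app se; apply: filterS3 sp sn regular_all => w wp wn wr we; split => //.
- move=> eps eps0; have e2 : 0 < eps / 2 by rewrite divr_gt0.
  have [Cp hCp] := wp _ e2; have [Cn hCn] := wn _ e2; exists (Cp + Cn) => n.
  have -> : \sum_(k < n) real_log_mean (xi (Posz k.+1) w) - n%:R * a =
     (\sum_(k < n) hp (xi (Posz k.+1) w) - n%:R * ap) -
     (\sum_(k < n) hn (xi (Posz k.+1) w) - n%:R * an).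
    rewrite (eq_bigr (fun k : 'I_n => hp (xi (Posz k.+1) w) - hn (xi (Posz k.+1) w))).
      by rewrite sumrB apn; ring.
    by move=> k _; exact: hpn.
  apply: le_trans (ler_normB _ _) _; have := hCp n; have := hCn n; lra.
- have [C hC] := we 1 ltr01; pose e := \int[PE]_w real_eta (xi 1%R w).
  exists (`|C| + `|e| + 1) => n; have := hC n; rewrite mul1r ler_norml => /andP[_].
  have n0 : 0 <= n%:R :> R by [].
  rewrite -/e => h.
  have h1 := ler_norm C; have h2 := ler_norm e.
  have h3 : 0 <= `|C| * n%:R by rewrite mulr_ge0.
  have h4 : n%:R * e <= n%:R * `|e| by rewrite ler_wpM2l.
  have h5 := normr_ge0 e; lra.
Qed.

End typical_environments.

(** * Decay of the quenched tail *)
Section quenched_asymptotics.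
Context (R : realType) (mu : probability (measurableTypeR R) R).
Hypothesis mu_hyp : jump_law_hyp mu.
Context (F : int -> probability nat R) (a : R).
Local Open Scope ring_scope.
Hypothesis a_lt0 : a < 0.
Hypothesis F_regular : forall k : nat, regular (F (Posz k.+1)).
Hypothesis F_log : forall eps : R, 0 < eps -> exists C : R, forall n : nat,
  `|\sum_(k < n) real_log_mean (F (Posz k.+1)) - n%:R * a| <= C + eps * n%:R.
Hypothesis F_eta : exists C : R, forall n : nat,
  \sum_(k < n) real_eta (F (Posz k.+1)) <= C * (n%:R + 1).
Variable lambda0 : R.
Hypothesis lambda0_gt0 : 0 < lambda0.
Local Notation p := (defect_law mu).
Hypothesis lambda0_root : jump_mgf p lambda0 = expR (- a).
Variable B : brw mu F.

Let f k := F (Posz k.+1).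
Let m k := real_mean (f k).
Let b k := fine (fact_moment (f k)).

Let m_gt0 k : 0 < m k.
Proof. by case: (regular_mean (F_regular k)). Qed.

Let f_mean k : (\int[f k]_n (n%:R)%:E = (m k)%:E)%E.
Proof.
have [_ <-] := regular_mean (F_regular k).
by rewrite nat_integral // => n; rewrite lee_fin.
Qed.

Let f_fact k : (\int[f k]_n ((n * n.-1)%:R)%:E = (b k)%:E)%E.
Proof.
have [b' [bE _]] := regular_eta (F_regular k).
rewrite /b bE /= -bE fact_moment_series.
by rewrite nat_integral // => n; rewrite lee_fin.
Qed.

Let eta_real k : eta m b k = real_eta (F (Posz k.+1)).
Proof.
by have [b' [bE ->]] := regular_eta (F_regular k); rewrite /eta /b bE.
Qed.

Lemma prod_mean_exp n :
  prod_mean m n = expR (\sum_(k < n) real_log_mean (F (Posz k.+1))).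
Proof.
elim: n => [|n IH]; first by rewrite /prod_mean !big_ord0 expR0.
rewrite prod_meanS IH big_ord_recr /= expRD; congr (_ * _).
by rewrite /real_log_mean lnK // posrE; exact: m_gt0.
Qed.

Lemma prod_mean_bounds eps : 0 < eps -> exists C : R, forall k,
  expR (- C + (a - eps) * k%:R) <= prod_mean m k <= expR (C + (a + eps) * k%:R).
Proof.
move=> e0; have [C hC] := F_log e0; exists C => k.
rewrite prod_mean_exp !ler_expR; have := hC k; rewrite ler_norml => /andP[h1 h2].
by apply/andP; split; lra.
Qed.

Lemma nat_above (x : R) : 0 < x -> exists z : nat, z%:R - 1 < x <= z%:R.
Proof.
move=> x0; have ex : exists n : nat, x <= n%:R.
  by exists (Num.truncn x).+1; exact/ltW/truncnS_gt.
case: (ex_minnP ex) => z hz zmin; exists z; rewrite hz andbT.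
rewrite ltNge; apply/negP => h.
have z0 : (0 < z)%N by rewrite lt0n; apply/eqP => z0; move: hz; rewrite z0 leNgt x0.
have := zmin z.-1; have -> : z.-1%:R = z%:R - 1 :> R by rewrite -subn1 natrB.
by move=> /(_ h); rewrite -ltnS prednK // ltnn.
Qed.

(** Below [lambda0] the exponential moment of a jump is less than [e ^ (- a)], which
leaves room [eps] for the fluctuations of the log-means in [hit_upper]. *)
Lemma tail_upper lambda : 0 <= lambda < lambda0 -> exists C : R, forall x : R, 0 < x ->
  (quenched_tail B x <= (expR (C - lambda * x))%:E)%E.
Proof.
move=> /andP[l0 ll0].
have phi0 := jump_mgf_gt0 mu_hyp l0.
have phi_lt : jump_mgf p lambda < expR (- a).
  rewrite -lambda0_root; apply: jump_mgf_lt; first by rewrite l0.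
  by rewrite lambda0_root -expR0 ltr_expR oppr_gt0.
pose eps := - a - ln (jump_mgf p lambda).
have e0 : 0 < eps.
  by rewrite /eps subr_gt0 -ltr_expR lnK.
have [C hC] := prod_mean_bounds e0; exists C => x x0.
have [z /andP[z1 z2]] := nat_above x0.
apply: (quenched_tail_le B (jump_law_bounded mu_hyp) z1) => N.
have phi1 : expR (a + eps) * jump_mgf p lambda <= 1.
  have -> : a + eps = - ln (jump_mgf p lambda) by rewrite /eps; ring.
  by rewrite expRN lnK ?posrE // mulVf // lt0r_neq0.
have := hit_upper m_gt0 f_mean l0 (fun k => proj2 (andP (hC k))) phi1 N 0 z.
rewrite /prod_mean big_ord0 mul1r mulr0 addr0 => h.
apply: le_trans h _; rewrite -expRD ler_expR lerD2l mulNr lerN2.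
exact: ler_wpM2l.
Qed.

(** In [hit_lower] over a horizon of [T = K z] generations the sum of the [eta k]
grows linearly in [T], hence slower than [e ^ (eps T)], and all losses amount to
[e ^ (4 eps K z)] up to a constant; [eps] is such that [4 eps K = delta]. *)
Lemma tail_lower delta : 0 < delta -> exists C : R, forall x : R, 0 < x ->
  ((expR (- C - (lambda0 + delta) * x))%:E <= quenched_tail B x)%E.
Proof.
move=> d0.
(* a horizon of K z generations makes the truncation error e ^ (a K z)
   negligible against e ^ (- lambda0 z) *)
pose K := (Num.truncn ((lambda0 + 1) / - a)).+1.
have K0 : 0 < K%:R :> R by [].
have Ka : a * K%:R <= - lambda0 - 1.
  have : (lambda0 + 1) / - a <= K%:R by exact/ltW/truncnS_gt.
  by rewrite ler_pdivrMr ?oppr_gt0 //; lra.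
pose eps := delta / (4 * K%:R).
have e0 : 0 < eps by rewrite divr_gt0 // mulr_gt0.
have [C hC] := prod_mean_bounds e0.
have [Ce hCe] := F_eta.
have Ce0 : 0 <= Ce by have := hCe 0%N; rewrite big_ord0 add0r mulr1.
pose D := 1 + expR (2 * C) * (Ce * (eps^-1 + 1)).
have D0 : 1 <= D.
  by rewrite lerDl mulr_ge0 ?expR_ge0 // mulr_ge0 // addr_ge0 // invr_ge0 ltW.
have Dp : 0 < D by exact: lt_le_trans D0.
exists (C + 1 + ln D + lambda0 + delta) => x x0.
have [z /andP[z1 z2]] := nat_above x0.
pose T := (K * z)%N.
apply: le_trans (quenched_tail_ge B (jump_law_bounded mu_hyp) T z2).
rewrite lee_fin -[defect_law mu]/p -/f.
have zp : 1 <= z%:R :> R.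
  by rewrite ler1n lt0n; apply/eqP => zz; move: z2; rewrite zz leNgt x0.
have TE : T%:R = K%:R * z%:R :> R by rewrite natrM.
have T0 : 0 <= eps * T%:R by rewrite mulr_ge0 // ltW.
have := hit_lower m_gt0 f_mean f_fact z (ltW a_lt0) (ltW e0) (fun k _ => hC k)
  (ltW lambda0_gt0) lambda0_root (T := T).
set h := hit _ _ _ _ _; set S := \sum_(_ <= _ < _) _ => hlow.
have h0 : 0 <= h by case/andP: (hit_unit p f T 0 z).
have hS : S <= Ce * (T%:R + 1).
  by rewrite /S big_mkord; under eq_bigr do rewrite eta_real; exact: hCe.
have hT : T%:R + 1 <= (eps^-1 + 1) * expR (eps * T%:R).
  have h1 := expR_ge1Dx (eps * T%:R).
  rewrite mulrDl mul1r; apply: lerD; last by apply: le_trans h1; rewrite lerDl.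
  rewrite -[leLHS](mulKf (lt0r_neq0 e0)) ler_wpM2l ?invr_ge0 ?(ltW e0) //.
  by apply: le_trans h1; rewrite lerDr.
have hden : 1 + expR (2 * C + 2 * eps * T%:R) * S <= D * expR (3 * eps * T%:R).
  have -> : D * expR (3 * eps * T%:R) = expR (3 * eps * T%:R) +
      expR (2 * C) * (Ce * (eps^-1 + 1) * expR (3 * eps * T%:R)).
    by rewrite /D; ring.
  apply: lerD; first by rewrite -[leLHS]expR0 ler_expR -mulrA mulr_ge0.
  rewrite expRD -mulrA ler_wpM2l ?expR_ge0 //.
  have -> : 3 * eps * T%:R = 2 * eps * T%:R + eps * T%:R by ring.
  rewrite expRD [leRHS]mulrCA ler_wpM2l ?expR_ge0 //.
  by apply: le_trans hS _; rewrite -mulrA ler_wpM2l.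
have hnum : expR (- lambda0 * z%:R - 1) <= expR (- lambda0 * z%:R) - expR (a * T%:R).
  have e2 : 2 * expR (-1) <= 1 :> R.
    have := expR_ge1Dx (1 : R); rewrite -(ler_pM2r (expR_gt0 (-1 : R))) -expRD subrr expR0.
    by have -> : 1 + 1 = 2 :> R by ring.
  have e1 : expR (a * T%:R) <= expR (- lambda0 * z%:R) * expR (-1).
    rewrite -expRD ler_expR TE mulrA.
    have : a * K%:R * z%:R <= (- lambda0 - 1) * z%:R by rewrite ler_wpM2r.
    lra.
  rewrite expRD; have := ler_wpM2l (expR_ge0 (- lambda0 * z%:R)) e2; lra.
have hfin : expR (- C - eps * T%:R) * expR (- lambda0 * z%:R - 1) <=
    D * expR (3 * eps * T%:R) * h.
  apply: (@le_trans _ _ (expR (- C - eps * T%:R) *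
     (expR (- lambda0 * z%:R) - expR (a * T%:R)))).
    by rewrite ler_wpM2l ?expR_ge0.
  by apply: le_trans hlow _; rewrite ler_wpM2r.
have De : 0 < D * expR (3 * eps * T%:R) by rewrite mulr_gt0 ?expR_gt0.
rewrite -(ler_pM2l De); apply: le_trans hfin.
rewrite -{1}(lnK (x := D)) ?posrE // -!expRD ler_expR.
have e4 : 4 * eps * T%:R = delta * z%:R.
  by rewrite /eps TE; field; rewrite lt0r_neq0.
have hx : (lambda0 + delta) * z%:R <= (lambda0 + delta) * (x + 1).
  by rewrite ler_wpM2l ?addr_ge0 ?ltW //; lra.
lra.
Qed.

Lemma quenched_tail_cvg :
  ((x^-1)%:E * lne (quenched_tail B x) @[x --> +oo%R] --> (- lambda0)%:E)%E.
Proof.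
have tailE : forall x : R, 0 < x -> exists2 r : R, 0 < r & quenched_tail B x = r%:E.
  move=> x x0; have [C1 h1] := tail_lower ltr01.
  have [C2 h2] := @tail_upper 0 (introT andP (conj (lexx 0) lambda0_gt0)).
  have := h1 x x0; have := h2 x x0; case: (quenched_tail B x) => [r| |] //.
  by rewrite !lee_fin => _ h; exists r => //; apply: lt_le_trans h; exact: expR_gt0.
apply: cvg_EFin.
  near=> x; have x0 : 0 < x by near: x; exact: nbhs_pinfty_gt.
  by have [r r0 ->] := tailE x x0; rewrite lne_EFin.
apply/cvgrPdist_le => e e0.
pose d := Num.min e lambda0 / 2.
have d0 : 0 < d by rewrite divr_gt0 // lt_min e0.
have [de dl] : d <= e / 2 /\ d <= lambda0 / 2.
  by rewrite /d !ler_pM2r ?invr_gt0 // !ge_min !lexx orbT.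
have lam : 0 <= lambda0 - d < lambda0.
  by apply/andP; split; lra.
have [C1 h1] := tail_lower d0.
have [C2 h2] := tail_upper lam.
near=> x.
have x0 : 0 < x by near: x; exact: nbhs_pinfty_gt.
have xC1 : C1 <= e / 2 * x.
  by rewrite mulrC -ler_pdivrMr ?divr_gt0 //; near: x; apply: nbhs_pinfty_ge; exact: num_real.
have xC2 : C2 <= e / 2 * x.
  by rewrite mulrC -ler_pdivrMr ?divr_gt0 //; near: x; apply: nbhs_pinfty_ge; exact: num_real.
have := h1 x x0; have := h2 x x0; rewrite /=.
have [r r0 ->] := tailE x x0; rewrite !lee_fin lne_EFin //= => u l.
rewrite -[r]lnK ?posrE // !ler_expR in u l.
have hd : d * x <= e / 2 * x by rewrite ler_wpM2r // ltW.
rewrite ler_norml; apply/andP; split.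
  rewrite lerBrDr -(ler_pM2l x0).
  have -> : x * (- e + x^-1 * ln r) = - (e * x) + ln r by field; rewrite lt0r_neq0.
  lra.
rewrite lerBlDr -(ler_pM2l x0).
have -> : x * (e + x^-1 * ln r) = e * x + ln r by field; rewrite lt0r_neq0.
lra.
Unshelve. all: by end_near.
Qed.

End quenched_asymptotics.

Unset Implicit Arguments.

Theorem theorem1 (R : realType) (d : measure_display)
    (Omega : measurableType d) (PE : probability Omega R)
    (xi : int -> Omega -> probability nat R)
    (mu : probability (measurableTypeR R) R) (a : R)
    (xi_iid : iid_environment PE xi)
    (aE : \int[PE]_w log_mean xi 1%R w = a%:E)
    (a_lt0 : (a < 0)%R)
    (Lambda_e_fin : forall rho : R, (0 <= rho)%R -> Lambda_e PE xi rho < +oo)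
    (mu_hyp : jump_law_hyp mu)
    (eta_fin : \int[PE]_w eta_ xi 1%R w < +oo) :
  let lambda0 := kappa mu (- a) in
  unique (fun lambda : R => (0 < lambda)%R /\ Lambda_s mu lambda = (- a)%:E)
    lambda0 /\
  {ae PE, forall w, forall B : brw mu (fun k => xi k w),
    (x^-1)%:E * lne (quenched_tail B x) @[x --> +oo%R] --> (- lambda0)%:E}.
Proof.
move=> lambda0; have a0 : (0 < - a)%R by rewrite oppr_gt0.
have kU := kappa_unique mu_hyp a0; split => //.
have [[l0 lE] _] := kU.
have root := proj1 (Lambda_s_eq mu_hyp (- a)%R (ltW l0)) lE.
apply: filterS (environment_typical xi_iid aE eta_fin) => w [w1 w2 w3] B.
exact: (quenched_tail_cvg mu_hyp a_lt0 w1 w2 w3 l0 root).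
Qed.
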